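(* Let $\mu>0$ and let $\nu$ be a $\mu$-strongly log-concave probability measure on $\mathbb R^n$, i.e. $\nu(dx)=\exp(-V(x))\,dx$ with $\nabla^2V(x)\succeq\mu\,\mathrm{Id}$ for all $x\in\mathbb R^n$. Then for every $\eta>0$ the restricted Gaussian dynamics for $\nu$ with parameter $\eta$ satisfies $$\rho_{\mathrm{LS}}\bigl(P^{\mathrm{RGD}_\eta}(\nu)\bigr)\ge\frac{\mu}{\mu+1/\eta}.$$
   Context: For $y\in\mathbb R^n$, $\eta>0$, let $\mathcal S_{y,\eta}\nu$ be the probability measure $$\mathcal S_{y,\eta}\nu(dx)=\frac{\exp\left(-\frac1{2\eta}|x-y|^2\right)\nu(dx)}{\int_{\mathbb R^n}\exp\left(-\frac1{2\eta}|z-y|^2\right)\nu(dz)}.$$ The restricted Gaussian dynamics for $\nu$ with parameter $\eta$ is the Markov chain with transition kernel $P^{\mathrm{RGD}_\eta}(\nu)_{x\to A}=\mathbb E_{y\sim\mathcal N(x,\eta\,\mathrm{Id})}[\mathcal S_{y,\eta}\nu(A)]$; it is reversible with stationary measure $\nu$. Modified log-Sobolev (MLSI) coefficient of a reversible kernel $P$ with stationary measure $\nu$: $\rho_{\mathrm{LS}}(P)=1-\sup_{f}\frac{\mathrm{Ent}_\nu[Pf]}{\mathrm{Ent}_\nu[f]}$, supremum over measurable $f:\mathbb R^n\to[0,\infty)$ with $0<\mathrm{Ent}_\nu[f]<\infty$, where $\mathrm{Ent}_\nu[f]=\int f\log f\,d\nu-\int f\,d\nu\,\log\int f\,d\nu$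 and $Pf(x)=\int f(y)\,P_{x\to dy}$. *)

(* Defs.v *)
From HB Require Import structures.
From mathcomp Require Import all_boot all_order all_algebra.
From mathcomp Require Import all_classical all_reals all_analysis.
From mathcomp Require Import measurable_realfun.

Set Implicit Arguments.
Unset Strict Implicit.
Unset Printing Implicit Defensive.

Import Order.TTheory GRing.Theory Num.Theory.
Import numFieldNormedType.Exports.

Local Open Scope classical_set_scope.
Local Open Scope ring_scope.

(* R^n is ['rV[R]_n], with the product sigma-algebra (for [T = R] this is the
   Borel sigma-algebra), declared in the same way as the one of [n.-tuple T]. *)
Definition measure_rV_display : measure_display -> measure_display.
Proof. exact. Qed.

Section measurable_rV.
Context {d} {T : measurableType d}.
Variable n : nat.

Let coor : 'I_n -> 'rV[T]_n -> T := fun i x => x ord0 i.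

Let rV_set0 : g_sigma_preimage coor set0.
Proof. exact: sigma_algebra0. Qed.

Let rV_setC A : g_sigma_preimage coor A -> g_sigma_preimage coor (~` A).
Proof. exact: sigma_algebraC. Qed.

Let rV_bigcup (F : _^nat) : (forall i, g_sigma_preimage coor (F i)) ->
  g_sigma_preimage coor (\bigcup_i (F i)).
Proof. exact: sigma_algebra_bigcup. Qed.

HB.instance Definition _ := @isMeasurable.Build (measure_rV_display d)
  'rV[T]_n (g_sigma_preimage coor) rV_set0 rV_setC rV_bigcup.

End measurable_rV.

Lemma measurable_fun_rVP d1 d2 (T1 : measurableType d1)
    (T2 : measurableType d2) n (f : T1 -> 'rV[T2]_n) :
  measurable_fun [set: T1] f <->
  forall i, measurable_fun [set: T1] (fun t => f t ord0 i).
Proof.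
pose coor (i : 'I_n) (x : 'rV[T2]_n) := x ord0 i.
apply: (@iff_trans _ (g_sigma_preimage (fun i => coor i \o f) `<=` measurable)).
  rewrite g_sigma_preimage_comp; split=> [mf A [/= C preC <-]|prefS].
    exact: mf.
  by move=> _ A mA; apply: prefS; exists A.
split=> [tnthfS i|mf].
- move=> _ A mA.
  apply: tnthfS; apply: sub_sigma_algebra.
  case: n i => [[] []//|n i] in f coor *.
  rewrite -bigcup_mkord_ord.
  exists i; first exact: ltn_ord.
  by exists A => //; rewrite inord_val.
- apply: smallest_sub; first exact: sigma_algebra_measurable.
  case: n => [|n] in f coor mf *; first by rewrite big_ord0.
  rewrite -bigcup_mkord_ord; apply: bigcup_sub => i Ii.
  by move=> A [B mB <-]; exact: mf.
Qed.

Lemma measurable_coor d (T : measurableType d) n (i : 'I_n) :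
  measurable_fun [set: 'rV[T]_n] (fun x => x ord0 i).
Proof. exact: ((measurable_fun_rVP (@id 'rV[T]_n)).1 (@measurable_id _ _ _) i). Qed.

Lemma measurable_box_rV d (T : measurableType d) n (A : 'I_n -> set T) :
  (forall i, measurable (A i)) ->
  measurable [set x : 'rV[T]_n | forall i, A i (x ord0 i)].
Proof.
move=> mA; rewrite (_ : [set x | _] =
    \bigcap_(i in [set: 'I_n]) ((fun x : 'rV[T]_n => x ord0 i) @^-1` A i)).
  apply: fin_bigcap_measurable => // i _.
  by rewrite -[X in measurable X]setTI; exact: measurable_coor.
by apply/seteqP; split => x /= H i; [move=> _|]; exact: H.
Qed.

Section lebesgue_rV.
Context {R : realType}.

Definition glue_rV n (p : measurableTypeR R * 'rV[R]_n) : 'rV[R]_n.+1 :=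
  row_mx (p.1%:M : 'M[R]_1) p.2.

Lemma glue_rV0 n p : @glue_rV n p ord0 ord0 = p.1.
Proof.
have -> : (ord0 : 'I_n.+1) = lshift n (ord0 : 'I_1) by exact/val_inj.
by apply: etrans (row_mxEl _ _ _ _) _; rewrite mxE eqxx mulr1n.
Qed.

Lemma glue_rVS n p i : @glue_rV n p ord0 (lift ord0 i) = p.2 ord0 i.
Proof.
have -> : lift ord0 i = rshift 1 i by exact/val_inj.
exact: row_mxEr.
Qed.

Lemma measurable_glue_rV n : measurable_fun setT (@glue_rV n).
Proof.
apply/measurable_fun_rVP => i; case: (unliftP ord0 i) => [j ->|->].
  under eq_fun do rewrite glue_rVS.
  by apply: (measurableT_comp (measurable_coor j)); exact: measurable_snd.
by under eq_fun do rewrite glue_rV0; exact: measurable_fst.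
Qed.

Section step.
Variables (n : nat) (m : {sigma_finite_measure set 'rV[R]_n -> \bar R}).
Local Open Scope ereal_scope.

Definition lebesgue_step : set 'rV[R]_n.+1 -> \bar R :=
  pushforward (lebesgue_measure \x m) (@glue_rV n).

Let mglue A : measurable A -> measurable (@glue_rV n @^-1` A).
Proof. by move=> mA; rewrite -[X in measurable X]setTI; exact: measurable_glue_rV. Qed.

Let step0 : lebesgue_step set0 = 0.
Proof. by rewrite /lebesgue_step/pushforward preimage_set0 measure0. Qed.

Let step_ge0 A : 0 <= lebesgue_step A.
Proof. by rewrite /lebesgue_step /pushforward; exact: measure_ge0. Qed.

Let step_sigma_additive : semi_sigma_additive lebesgue_step.
Proof.
move=> F mF tF mUF; rewrite /lebesgue_step /pushforward preimage_bigcup.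
apply: measure_semi_sigma_additive.
- by move=> k; exact: mglue.
- apply/trivIsetP => /= i j _ _ ij; rewrite -preimage_setI.
  by move/trivIsetP : tF => /(_ _ _ _ _ ij) ->//; rewrite preimage_set0.
- by rewrite -preimage_bigcup; exact: mglue.
Qed.

HB.instance Definition _ := isMeasure.Build _ _ _ lebesgue_step
  step0 step_ge0 step_sigma_additive.

Lemma measurable_unglue_rV : measurable_fun setT
  (fun z : 'rV[R]_n.+1 => (z ord0 ord0 : measurableTypeR R,
                           \row_i z ord0 (lift ord0 i))).
Proof.
apply: measurable_fun_pair; first exact: measurable_coor.
apply/measurable_fun_rVP => i; under eq_fun do rewrite mxE.
exact: measurable_coor.
Qed.

Lemma glue_rVK : cancel (@glue_rV n) (fun z : 'rV[R]_n.+1 =>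
  (z ord0 ord0 : measurableTypeR R, \row_i z ord0 (lift ord0 i))).
Proof.
move=> [x v]; rewrite glue_rV0/=; congr pair.
by apply/rowP => i; rewrite mxE glue_rVS.
Qed.

Let step_sigma_finite : sigma_finite setT lebesgue_step.
Proof.
pose u (z : 'rV[R]_n.+1) :=
  (z ord0 ord0 : measurableTypeR R, \row_i z ord0 (lift ord0 i)).
have /sigma_finiteP[F [TF ndF Foo]] := sigma_finiteT (@lebesgue_measure R).
have /sigma_finiteP[G [TG ndG Goo]] := sigma_finiteT m.
exists (fun k => u @^-1` (F k `*` G k)).
  rewrite -preimage_bigcup (_ : \bigcup_k _ = setT) ?preimage_setT//.
  rewrite -setXTT TF TG predeqE => -[x y]; split=> [[k _ [/= Fx Gy]]|].
    by split; exists k.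
  move=> [/= [k _ Fkx] [l _ Gly]]; exists (maxn k l) => //; split.
  - by move: x Fkx; exact/subsetPset/ndF/leq_maxl.
  - by move: y Gly; exact/subsetPset/ndG/leq_maxr.
move=> k; have [mFk Fkoo] := Foo k; have [mGk Gkoo] := Goo k; split.
  rewrite -[X in measurable X]setTI; apply: measurable_unglue_rV => //.
  exact: measurableX.
rewrite /lebesgue_step /pushforward -comp_preimage.
rewrite (_ : u \o _ = id); last by apply/funext => p /=; exact: glue_rVK.
by rewrite product_measure1E// lte_mul_pinfty// ge0_fin_numE.
Qed.

HB.instance Definition _ := @Measure_isSigmaFinite.Build _ _ _ lebesgue_step
  step_sigma_finite.

End step.

(* Iterated product of the one-dimensional Lebesgue measure, transported along
   [R * R^n' -> R^n'.+1]; see [lebesgue_rV_box]. *)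
Fixpoint lebesgue_rV (n : nat) :
    {sigma_finite_measure set 'rV[R]_n -> \bar R} :=
  match n with
  | 0 => @dirac _ 'rV[R]_0 0 R
  | n'.+1 => lebesgue_step (lebesgue_rV n')
  end.

Lemma lebesgue_rV_box n (A : 'I_n -> set R) :
  (forall i, measurable (A i)) ->
  lebesgue_rV n [set x | forall i, A i (x ord0 i)] =
  (\prod_(i < n) lebesgue_measure (A i : set (measurableTypeR R)))%E.
Proof.
elim: n A => [|n IH] A mA /=.
  rewrite big_ord0 diracE mem_set//= => -[]//.
rewrite big_ord_recl /lebesgue_step /pushforward.
rewrite (_ : _ @^-1` _ = A ord0 `*`
    [set x : 'rV[R]_n | forall i, A (lift ord0 i) (x ord0 i)]); last first.
  apply/seteqP; split => [[x v] /= H|[x v] /= [H0 H] i].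
    split; first by have := H ord0; rewrite glue_rV0.
    by move=> i; have := H (lift ord0 i); rewrite glue_rVS.
  by case: (unliftP ord0 i) => [j ->|->]; rewrite ?glue_rVS ?glue_rV0.
rewrite product_measure1E.
- by congr *%E; apply: IH => i; exact: mA.
- exact: mA.
- exact: (@measurable_box_rV _ R n (fun i => A (lift ord0 i)) (fun i => mA _)).
Qed.

Lemma ge0_integral_rVS n (f : 'rV[R]_n.+1 -> \bar R) :
  measurable_fun [set: 'rV[R]_n.+1] f -> (forall z, (0 <= f z)%E) ->
  (\int[lebesgue_rV n.+1]_z f z =
   \int[lebesgue_measure]_x \int[lebesgue_rV n]_v f (glue_rV (x, v)))%E.
Proof.
move=> mf f0; rewrite [LHS]ge0_integral_pushforward//; last first.
  exact: measurable_glue_rV.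
rewrite preimage_setT fubini_tonelli1//.
by apply: measurableT_comp => //; exact: measurable_glue_rV.
by move=> x; exact: f0.
Qed.

Lemma integral_prod_rV n (g : 'I_n -> R -> R) :
  (forall i, measurable_fun setT (g i)) -> (forall i x, 0 <= g i x) ->
  (forall i, \int[lebesgue_measure]_x (g i x)%:E = 1)%E ->
  (\int[lebesgue_rV n]_z (\prod_(i < n) g i (z ord0 i))%:E = 1)%E.
Proof.
elim: n g => [|n IH] g mg g0 g1.
  under eq_integral do rewrite big_ord0.
  by rewrite integral_cst// mul1e; exact: diracT.
have mprod k (h : 'I_k -> R -> R) : (forall i, measurable_fun setT (h i)) ->
    measurable_fun setT (fun z : 'rV[R]_k => (\prod_(i < k) h i (z ord0 i))%:E).
  move=> mh; apply/measurable_EFinP; apply: measurable_prod => i _.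
  by apply: measurableT_comp => //; exact: measurable_coor.
rewrite ge0_integral_rVS; last 2 first.
- exact: mprod.
- by move=> z; rewrite lee_fin prodr_ge0.
rewrite -[RHS](g1 ord0); apply: eq_integral => x _.
rewrite (eq_integral (fun v : 'rV[R]_n => ((g ord0 x)%:E *
    (\prod_(i < n) g (lift ord0 i) (v ord0 i))%:E)%E)); last first.
  move=> v _; rewrite big_ord_recl glue_rV0 -EFinM.
  by under eq_bigr do rewrite glue_rVS.
rewrite ge0_integralZl//.
- by rewrite (IH (fun i => g (lift ord0 i)))// mule1.
- exact: (mprod _ (fun i => g (lift ord0 i))).
- by move=> v _; rewrite lee_fin prodr_ge0.
- by rewrite lee_fin.
Qed.

End lebesgue_rV.

(* The kernel [x |-> w (x, y) m(dy)]. *)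
Section kdensity.
Context d1 d2 (T1 : measurableType d1) (T2 : measurableType d2) (R : realType).
Variables (m : {sigma_finite_measure set T2 -> \bar R}) (w : T1 * T2 -> R).
Local Open Scope ereal_scope.

Definition kdensity (mw : measurable_fun setT w) (w0 : forall z, (0 <= w z)%R)
    (x : T1) (A : set T2) : \bar R :=
  \int[m]_(y in A) (w (x, y))%:E.

Hypotheses (mw : measurable_fun setT w) (w0 : forall z, (0 <= w z)%R).

Let mwx x : measurable_fun setT (fun y => (w (x, y))%:E).
Proof. by apply/measurable_EFinP/measurableT_comp. Qed.

Let kdensity0 x : kdensity mw w0 x set0 = 0.
Proof. by rewrite /kdensity integral_set0. Qed.

Let kdensity_ge0 x A : 0 <= kdensity mw w0 x A.
Proof. by apply: integral_ge0 => y _; rewrite lee_fin. Qed.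

Let kdensity_sigma_additive x : semi_sigma_additive (kdensity mw w0 x).
Proof.
move=> F mF tF mUF; rewrite /kdensity ge0_integral_bigcup//.
- apply: is_cvg_ereal_nneg_natsum_cond => k _ _.
  by apply: integral_ge0 => y _; rewrite lee_fin.
- exact: measurable_funTS.
- by move=> y _; rewrite lee_fin.
Qed.

HB.instance Definition _ x := isMeasure.Build _ _ _ (kdensity mw w0 x)
  (kdensity0 x) (kdensity_ge0 x) (@kdensity_sigma_additive x).

Definition mkdensity : T1 -> {measure set T2 -> \bar R} := kdensity mw w0.

Let measurable_kdensity U :
  measurable U -> measurable_fun setT (mkdensity ^~ U).
Proof.
move=> mU; rewrite (_ : mkdensity ^~ U = fubini_F m
    (fun z => (w z * \1_U z.2)%:E)); last first.
  apply/funext => x; rewrite /mkdensity /= /kdensity integral_mkcond.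
  apply: eq_integral => y _; rewrite patchE indicE.
  by case: ifP => _; rewrite ?mulr1 ?mulr0.
apply: measurable_fun_fubini_tonelli_F => [|z].
  apply/measurable_EFinP; apply: measurable_funM => //.
  by apply: measurableT_comp => //; exact: measurable_indic.
by rewrite lee_fin mulr_ge0.
Qed.

HB.instance Definition _ := isKernel.Build _ _ _ _ _ mkdensity
  measurable_kdensity.

End kdensity.

Section restricted_gaussian_dynamics.
Context {R : realType} {n : nat}.
Implicit Types (x y z : 'rV[R]_n) (eta : R).

(* squared Euclidean norm; the norm [`| x |] of ['rV[R]_n] is the sup norm *)
Definition sqnorm x : R := \sum_(i < n) x ord0 i ^+ 2.

Definition gaussian_weight eta (p : 'rV[R]_n * 'rV[R]_n) : R :=
  expR (- (2 * eta)^-1 * sqnorm (p.2 - p.1)).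

Lemma gaussian_weight_ge0 eta p : 0 <= gaussian_weight eta p.
Proof. exact: expR_ge0. Qed.

Lemma measurable_gaussian_weight eta :
  measurable_fun setT (gaussian_weight eta).
Proof.
apply: measurableT_comp => //; apply: measurable_funM => //.
apply: measurable_sum => i; apply: measurable_funX.
under eq_fun do rewrite !mxE.
apply: measurable_funB.
  by apply: (measurableT_comp (measurable_coor i)); exact: measurable_snd.
by apply: (measurableT_comp (measurable_coor i)); exact: measurable_fst.
Qed.

(* density at [p.2] of [N(p.1, eta Id)]; [normal_pdf] takes the standard
   deviation as a parameter *)
Definition gaussian_pdf eta (p : 'rV[R]_n * 'rV[R]_n) : R :=
  \prod_(i < n) normal_pdf (p.1 ord0 i) (Num.sqrt eta) (p.2 ord0 i).

Lemma gaussian_pdf_ge0 eta p : 0 <= gaussian_pdf eta p.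
Proof. by apply: prodr_ge0 => i _; exact: normal_pdf_ge0. Qed.

Lemma gaussian_pdfE eta p : 0 < eta ->
  gaussian_pdf eta p = (Num.sqrt (2 * pi * eta) ^+ n)^-1 * gaussian_weight eta p.
Proof.
move=> eta0; have s0 : Num.sqrt eta != 0 by rewrite gt_eqF// sqrtr_gt0.
rewrite /gaussian_pdf /gaussian_weight /sqnorm mulr_sumr expR_sum.
rewrite (eq_bigr (fun i => normal_peak (Num.sqrt eta) *
    normal_fun (p.1 ord0 i) (Num.sqrt eta) (p.2 ord0 i))); last first.
  by move=> i _; rewrite normal_pdfE.
rewrite big_split/= prodr_const card_ord /normal_peak sqr_sqrtr ?ltW//.
rewrite exprVn; congr ((Num.sqrt _ ^+ _)^-1 * _).
  by rewrite -mulr_natl -mulrA [pi * eta]mulrC.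
apply: eq_bigr => i _; rewrite /normal_fun sqr_sqrtr ?ltW// !mxE.
by congr expR; rewrite -mulr_natl !mulNr mulrC.
Qed.

Lemma measurable_gaussian_pdf eta : measurable_fun setT (gaussian_pdf eta).
Proof.
apply: measurable_prod => i _; rewrite /normal_pdf.
have m1 : measurable_fun setT (fun p : 'rV[R]_n * 'rV[R]_n => p.1 ord0 i).
  by apply: (measurableT_comp (measurable_coor i)); exact: measurable_fst.
have m2 : measurable_fun setT (fun p : 'rV[R]_n * 'rV[R]_n => p.2 ord0 i).
  by apply: (measurableT_comp (measurable_coor i)); exact: measurable_snd.
case: (Num.sqrt eta == 0).
  by apply: measurableT_comp => //; exact: measurable_indic.
apply: measurable_funM => //; apply: measurableT_comp => //.
apply: measurable_funM => //; apply: measurableT_comp => //.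
by apply: measurable_funX; exact: measurable_funB.
Qed.

(* [x |-> N(x, eta Id)] *)
Definition gaussian_kernel eta : 'rV[R]_n -> {measure set 'rV[R]_n -> \bar R} :=
  mkdensity (lebesgue_rV n) (measurable_gaussian_pdf eta)
    (gaussian_pdf_ge0 eta).

HB.instance Definition _ eta := Kernel.on (gaussian_kernel eta).

Let gaussian_kernel_setT eta x : gaussian_kernel eta x setT = 1%E.
Proof.
rewrite /gaussian_kernel /mkdensity /= /kdensity /gaussian_pdf /=.
apply: (integral_prod_rV
  (g := fun i => normal_pdf (x ord0 i) (Num.sqrt eta))) => *.
- exact: measurable_normal_pdf.
- exact: normal_pdf_ge0.
- exact: integral_normal_pdf.
Qed.

HB.instance Definition _ eta := Kernel_isProbability.Build _ _ _ _ _
  (gaussian_kernel eta) (gaussian_kernel_setT eta).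

Variables (eta : R) (nu : probability 'rV[R]_n R).

(* [y |-> S_{y, eta} nu]; for [0 < eta] the total mass of the measure being
   normalized lies in ]0, 1], so the default value [nu] of [knormalize] is
   not used. *)
Definition tilt : 'rV[R]_n -> {measure set 'rV[R]_n -> \bar R} :=
  knormalize (mkdensity nu (measurable_gaussian_weight eta)
    (gaussian_weight_ge0 eta)) nu.

HB.instance Definition _ := ProbabilityKernel.on tilt.

Lemma tiltE y (A : set 'rV[R]_n) : 0 < eta ->
  (tilt y A = (\int[nu]_(x in A) (gaussian_weight eta (y, x))%:E) /
              (\int[nu]_x (gaussian_weight eta (y, x))%:E))%E.
Proof.
move=> eta0; rewrite /tilt /knormalize /= /mnormalize /mkdensity /= /kdensity.
set Z := (\int[nu]_x _)%E.
have mw : measurable_fun [set: 'rV[R]_n]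
    (fun x => (gaussian_weight eta (y, x))%:E).
  apply/measurable_EFinP.
  exact: (measurableT_comp (measurable_gaussian_weight eta)).
have Z1 : (Z <= 1)%E.
  rewrite -(@probability_setT _ _ _ nu) -[leRHS]mul1e -integral_cst//.
  apply: ge0_le_integral => // [x _|x _].
    by rewrite lee_fin gaussian_weight_ge0.
  rewrite lee_fin -expR0 ler_expR mulNr oppr_le0 mulr_ge0//.
    by rewrite invr_ge0 mulr_ge0// ltW.
  by apply: sumr_ge0 => i _; exact: sqr_ge0.
have Z0 : Z != 0%E.
  apply/eqP => Z0.
  have : (\int[nu]_x `|(gaussian_weight eta (y, x))%:E| = 0)%E.
    rewrite -Z0; apply: eq_integral => x _.
    by rewrite gee0_abs// lee_fin gaussian_weight_ge0.
  move=> /(ae_eq_integral_abs nu measurableT mw).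
  move=> [N [mN nuN0 HN]].
  have : (nu setT <= 0)%E.
    rewrite -nuN0; apply: le_measure; rewrite ?inE// => x _; apply: HN => /=.
    by move/(_ I)/eqP; rewrite eqe gt_eqF// expR_gt0.
  by rewrite probability_setT lee_fin ler10.
have Zoo : Z != +oo%E by rewrite lt_eqF// (le_lt_trans Z1)// ltry.
rewrite (negbTE Z0) (negbTE Zoo)/=; congr (_ * _)%E.
have Zfin : Z \is a fin_num.
  rewrite ge0_fin_numE ?(le_lt_trans Z1) ?ltry//.
  by apply: integral_ge0 => x _; rewrite lee_fin gaussian_weight_ge0.
by rewrite -[in RHS](fineK Zfin) inver fine_eq0// (negbTE Z0).
Qed.

(* [x, A |-> \int[gaussian_kernel eta x]_y tilt y A] *)
Definition rgd : 'rV[R]_n -> {measure set 'rV[R]_n -> \bar R} :=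
  mkcomp_noparam (gaussian_kernel eta) tilt.

HB.instance Definition _ := Kernel.on rgd.

Let rgd_setT x : rgd x setT = 1%E.
Proof.
rewrite /rgd /mkcomp_noparam/= /kcomp_noparam.
under eq_integral do rewrite prob_kernel.
by rewrite integral_cst// mul1e prob_kernel.
Qed.

HB.instance Definition _ := Kernel_isProbability.Build _ _ _ _ _ rgd rgd_setT.

End restricted_gaussian_dynamics.

Section strongly_log_concave.
Context {R : realType} {n : nat}.
Implicit Types (V : 'rV[R]_n -> R) (x : 'rV[R]_n).

Definition gradient V x : 'rV[R]_n := \row_i 'D_(delta_mx ord0 i) V x.

Definition hessian V x : 'M[R]_n := 'J (gradient V) x.

Definition twice_differentiable V :=
  (forall x, differentiable V x) /\ (forall x, differentiable (gradient V) x).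

(* No symmetry is required: the Hessian of a twice differentiable function is
   symmetric. *)
Definition loewner_le (A B : 'M[R]_n) := forall v : 'rV[R]_n,
  (v *m A *m v^T) ord0 ord0 <= (v *m B *m v^T) ord0 ord0.

Definition strongly_log_concave (mu : R) (nu : probability 'rV[R]_n R) :=
  exists V : 'rV[R]_n -> R,
    [/\ twice_differentiable V,
        forall x, loewner_le mu%:M (hessian V x) &
        forall A, measurable A ->
          nu A = (\int[lebesgue_rV n]_(x in A) (expR (- V x))%:E)%E].

End strongly_log_concave.

Section modified_log_sobolev.
Context d (T : measurableType d) (R : realType).
Implicit Types (nu : probability T R) (P : R.-ker T ~> T).
Local Open Scope ereal_scope.

(* [0 * lne 0 = 0 * -oo = 0], as usual. When [f] is nonnegative and not
   [nu]-integrable, [entropy nu f = +oo - +oo = -oo]. *)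
Definition entropy nu (f : T -> \bar R) : \bar R :=
  \int[nu]_x (f x * lne (f x)) - (\int[nu]_x f x) * lne (\int[nu]_x f x).

(* [P f]; it may take the value [+oo] even if [f] is finite *)
Definition kernel_apply P (f : T -> \bar R) (x : T) : \bar R :=
  \int[P x]_y f y.

Definition rho_LS P nu : \bar R :=
  1 - ereal_sup [set entropy nu (kernel_apply P (EFin \o f)) /
                     entropy nu (EFin \o f) |
    f in [set f : T -> R | [/\ measurable_fun setT f,
                               forall x, (0 <= f x)%R &
                               0 < entropy nu (EFin \o f) < +oo]]].

End modified_log_sobolev.

(* Main.v *)
(* One step of the dynamics is [P = G S], with [G] the Gaussian kernel and [S]
   the tilt.  Put [l = 1 / (1 + mu eta)].  Jensen's inequality and a change of
   Gaussian mean give, for [z = (1 - l) x + l y],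
     G(e^g)(z) >= exp(G g(y) - (1 - l)^2 |y - x|^2 / (2 eta)),
   and this loss is exactly what the strong convexity of [V] between [x] and [y]
   compensates.  Hence [u = e^-V], [v = e^(G g / l - V)], [w = G(e^g) e^-V]
   satisfy the hypothesis of the Prekopa-Leindler inequality with weight [l], so
     log (\int e^(G g / l) dnu) <= (1 / l) log (\int G(e^g) dnu).
   By Gibbs duality, with [g = S t], Jensen, and the reversibility of [P], this
   becomes
     \int (P f) t dnu <= l Ent f + (\int f) log (\int e^t dnu),
   and letting the bounded function [t] tend to [log (P f)] yields
   [Ent (P f) <= l Ent f]. *)

Require Import Defs.
From mathcomp Require Import all_boot all_order all_algebra.
From mathcomp Require Import all_classical all_reals all_analysis.
From mathcomp Require Import measurable_realfun.
From mathcomp Require Import ring lra.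

Set Implicit Arguments.
Unset Strict Implicit.
Unset Printing Implicit Defensive.

Import Order.TTheory GRing.Theory Num.Theory.
Import numFieldNormedType.Exports.

Local Open Scope classical_set_scope.
Local Open Scope ring_scope.

(** * The one-dimensional Brunn-Minkowski inequality *)

(** [Ent (P f)] is nonlinear in [P f], while its dual pairing with a bounded [t] is linear;
    reversibility then moves [P] onto [t], and what remains are exponential integrals, which
    Prekopa-Leindler controls. The gain comes from applying Gibbs duality to [P t / l] rather than
    to [P t]: the entropy of [f] acquires the factor [l], and the comparison of
    [\int e^(G g / l) dnu] with [\int G(e^g) dnu] pays for the larger exponent. Passing from
    [G(e^g)] to [e^t] is free, since [e^(S t) <= S(e^t)] pointwise and [nu] is stationary for [G S].
    The value of [l] balances the Gaussian loss [(1 - l)^2 / (2 eta)] against the convexity gain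
    [mu l (1 - l) / 2], that is, [1 - l = mu eta l]. The recurrent obstacle is integrability: [P f]
    may take the value [+oo] and its logarithm may be unbounded, so the test functions are bounded
    and shifted to be nonnegative. *)

Section lebesgue_measure_affine.
Context {R : realType}.
Local Notation leb := (@lebesgue_measure R).
Implicit Types A : set (measurableTypeR R).

Lemma measurable_affine (r c : R) : measurable_fun [set: measurableTypeR R]
  ((fun x => r * x + c) : measurableTypeR R -> measurableTypeR R).
Proof. by apply: measurable_funD => //; apply: measurable_funM. Qed.

Lemma measurable_reflect (c : R) : measurable_fun [set: measurableTypeR R]
  ((fun x => c - x) : measurableTypeR R -> measurableTypeR R).
Proof. exact: measurable_funB. Qed.

(** Both sides are measures in [A] that agree on half-open intervals, which determine Lebesgue
    measure. *)
Lemma lebesgue_measure_scale (r c : R) A : 0 < r -> measurable A ->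
  leb A = (r%:E * leb ((fun x => r * x + c)%R @^-1` A))%E.
Proof.
move=> r0 mA.
pose phi : measurableTypeR R -> measurableTypeR R := fun x => r * x + c.
have mphi : measurable_fun setT phi := measurable_affine r c.
pose m := mscale (NngNum (ltW r0))
  (measure_function_pushforward__canonical__measure_function_Measure leb mphi).
rewrite (@lebesgue_measure_unique _ m) => // X [[a b]] /= ab <-.
rewrite /m /mscale/= /pushforward.
rewrite (_ : phi @^-1` _ = `](a - c) / r, (b - c) / r]%classic); last first.
  by apply/seteqP; split => x; rewrite /= !in_itv /= ltr_pdivrMr// ler_pdivlMr//
    ltrBlDr lerBrDr mulrC.
rewrite !lebesgue_measure_itv /= !lte_fin ltr_pM2r ?invr_gt0// ltrD2r.
case: ifPn; rewrite ?mule0// => _; rewrite -!EFinB -EFinM; congr EFin.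
by field; rewrite gt_eqF.
Qed.

Lemma lebesgue_measure_reflect (c : R) A : measurable A ->
  pushforward leb ((fun x => c - x) : measurableTypeR R -> measurableTypeR R) A
  = leb A.
Proof.
move=> mA; apply/esym.
pose m := measure_function_pushforward__canonical__measure_function_Measure
  leb (measurable_reflect c).
apply: (@lebesgue_measure_unique _ m) => // X [[a b]] /= ab <-.
rewrite /pushforward.
rewrite (_ : _ @^-1` _ = `[c - b, c - a[%classic); last first.
  apply/seteqP; split => x /=; rewrite !in_itv/= => /andP[? ?]; apply/andP; split; lra.
rewrite !lebesgue_measure_itv /= !lte_fin.
rewrite (_ : (c - b < c - a) = (a < b)); last by apply/idP/idP => ?; lra.
by case: ifPn => // _; rewrite -!EFinB; congr EFin; ring.
Qed.

Lemma ge0_integral_reflect (c : R) (f : R -> \bar R) :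
  measurable_fun [set: measurableTypeR R] f -> (forall x, 0 <= f x)%E ->
  (\int[leb]_x f (c - x)%R = \int[leb]_x f x)%E.
Proof.
move=> mf f0.
pose m := measure_function_pushforward__canonical__measure_function_Measure
  leb (measurable_reflect c).
transitivity (\int[m]_x f x)%E; last first.
  by apply: eq_measure_integral => A mA _; exact: lebesgue_measure_reflect.
by rewrite ge0_integral_pushforward//; exact: measurable_reflect.
Qed.

(** Inner approximation produces strict real lower bounds of each term; this form lets infinite
    terms be treated together with finite ones. *)
Lemma leeD_sup_fin (a b c : \bar R) :
  (forall s t : R, s%:E < a -> t%:E < b -> (s + t)%:E <= c)%E -> (a + b <= c)%E.
Proof.
case: a b => [a| |] [b| |] H; rewrite ?addeNy ?leNye//.
- apply/lee_addgt0Pr => e e0; rewrite -leeBlDr//.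
  rewrite -!EFinD (_ : _ - e = (a - e / 2) + (b - e / 2)); last by field.
  by apply: H; rewrite lte_fin; lra.
- rewrite addey// leye_eq; apply/eqP/eq_infty => M.
  rewrite (_ : M = (a - 1) + (M - a + 1)); last by ring.
  by apply: H; rewrite ?ltry// lte_fin; lra.
- rewrite leye_eq; apply/eqP/eq_infty => M.
  rewrite (_ : M = (M - b + 1) + (b - 1)); last by ring.
  by apply: H; rewrite ?ltry// lte_fin; lra.
- rewrite leye_eq; apply/eqP/eq_infty => M.
  by rewrite -[M]addr0; apply: H; rewrite ltry.
Qed.

(* For compact sets the two scaled copies [(1 - l) A + l (min B)] and
   [(1 - l) (max A) + l B] of [A] and [B] lie in [C] and meet in one point. *)
Lemma brunn_minkowski1 (l : R) A B C : 0 < l < 1 ->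
  measurable A -> measurable B -> measurable C -> A !=set0 -> B !=set0 ->
  (forall x y, A x -> B y -> C ((1 - l) * x + l * y)) ->
  ((1 - l)%:E * leb A + l%:E * leb B <= leb C)%E.
Proof.
move=> /andP[l0 l1] mA mB mC A0 B0 ABC.
have l10 : 0 < 1 - l by lra.
have mcompact (K : set R) : compact K -> measurable K.
  by move=> cK; apply: closed_measurable; apply: compact_closed => //;
    exact: Rhausdorff.
have core (K L : set R) : compact K -> compact L -> K `<=` A -> L `<=` B ->
    K !=set0 -> L !=set0 -> ((1 - l)%:E * leb K + l%:E * leb L <= leb C)%E.
  move=> cK cL KA LB K0 L0.
  have [a Ka amax] := compact_EVT_max K0 cK (@continuous_subspaceT _ _ K id (fun x =>
    cvg_id)).
  have [b Lb bmin] := compact_EVT_min L0 cL (@continuous_subspaceT _ _ L id (fun x =>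
    cvg_id)).
  rewrite inE in Ka; rewrite inE in Lb.
  pose K' := (fun x => (1 - l)^-1 * x + (- (l * b / (1 - l)))) @^-1` K.
  pose L' := (fun x => l^-1 * x + (- ((1 - l) * a / l))) @^-1` L.
  have mK' : measurable (K' : set (measurableTypeR R)).
    rewrite -[X in measurable X]setTI; apply: (measurable_affine _ _) => //.
    exact: mcompact.
  have mL' : measurable (L' : set (measurableTypeR R)).
    rewrite -[X in measurable X]setTI; apply: (measurable_affine _ _) => //.
    exact: mcompact.
  have li : (1 - l) / (1 - l) = 1 by rewrite divff ?gt_eqF.
  have li' : l / l = 1 by rewrite divff ?gt_eqF.
  have K'C x : K' x -> C x.
    move=> K'x; have := ABC _ _ (KA _ K'x) (LB _ Lb).
    by congr C; field; rewrite gt_eqF.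
  have L'C x : L' x -> C x.
    move=> L'x; have := ABC _ _ (KA _ Ka) (LB _ L'x).
    by congr C; field; rewrite gt_eqF.
  (* Since [a] is the maximum of [K] and [b] the minimum of [L], [K'] lies to the left of this point
     and [L'] to its right. *)
  have K'L' : K' `&` L' `<=` [set (1 - l) * a + l * b].
    move=> x [/= /mem_set/amax K'x /mem_set/bmin L'x]; apply/eqP; rewrite eq_le.
    have : (1 - l) * ((1 - l)^-1 * x - l * b / (1 - l)) <= (1 - l) * a by rewrite
      ler_pM2l.
    rewrite (_ : _ * (_ - _) = x - l * b); last by field; rewrite gt_eqF.
    have : l * b <= l * (l^-1 * x - (1 - l) * a / l) by rewrite ler_pM2l.
    rewrite (_ : _ * (_ - _) = x - (1 - l) * a); last by field; rewrite gt_eqF.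
    by move=> ? ?; apply/andP; split; lra.
  rewrite (@lebesgue_measure_scale (1 - l)^-1 (- (l * b / (1 - l))) K) ?invr_gt0//;
    last exact: mcompact.
  rewrite (@lebesgue_measure_scale l^-1 (- ((1 - l) * a / l)) L) ?invr_gt0//;
    last exact: mcompact.
  rewrite !muleA -!EFinM li li' !mul1e -/K' -/L'.
  have mK'D : measurable (K' `\` L' : set (measurableTypeR R)) by exact: measurableD.
  have -> : leb K' = leb (K' `\` L').
    apply: (etrans (measureDI lebesgue_measure mK' mL')).
    rewrite -[RHS]adde0; congr (_ + _)%E.
    apply/eqP; rewrite eq_le measure_ge0 andbT.
    rewrite -(@lebesgue_measure_set1 R ((1 - l) * a + l * b)).
    by apply: le_measure => //; rewrite inE//; exact: measurableI.
  rewrite -measureU//; last by apply/seteqP; split => // x [[]].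
  apply: le_measure => //; rewrite ?inE//; first exact: measurableU.
  by move=> x [[/K'C]|/L'C].
(* Inner regularity may return the empty compact set; adjoining [x0] keeps it nonempty, so that the
   extrema used in [core] exist. *)
have approx (D : set R) (x0 : R) (s : R) : measurable D -> D x0 ->
    (s%:E < leb D)%E ->
    exists K, [/\ compact K, K `<=` D, K !=set0 & (s%:E < leb K)%E].
  move=> mD Dx0; rewrite (lebesgue_regularity_inner_sup mD).
  move=> /ereal_sup_gt[_ [K [cK KD] <-] sK].
  exists (K `|` [set x0]); split; first exact: compactU cK (@compact_set1 _ _).
  - by move=> x [/KD//|->].
  - by exists x0; right.
  apply: (lt_le_trans sK); apply: le_measure => [||x]; last by left.
  - by rewrite inE; exact: mcompact.
  - by rewrite inE; apply: measurableU => //; exact: mcompact.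
have [a0 Aa0] := A0; have [b0 Bb0] := B0.
apply: leeD_sup_fin => s t.
rewrite -lte_pdivrMl// -EFinM => /(approx _ _ _ mA Aa0)[K [cK KA K0 sK]].
rewrite -lte_pdivrMl// -EFinM => /(approx _ _ _ mB Bb0)[L [cL LB L0 tL]].
apply: le_trans (core K L cK cL KA LB K0 L0).
rewrite EFinD; apply: leeD.
  by rewrite -lee_pdivrMl// -EFinM ltW.
by rewrite -lee_pdivrMl// -EFinM ltW.
Qed.

End lebesgue_measure_affine.

(** * The one-dimensional Prekopa-Leindler inequality *)

Section layer_cake.
Context d (T : measurableType d) {R : realType}.
Variable m : {sigma_finite_measure set T -> \bar R}.
Local Notation leb := (@lebesgue_measure R).
Local Open Scope ereal_scope.

Lemma measurable_hypograph (f : T -> R) : measurable_fun setT f ->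
  measurable [set z : measurableTypeR R * T | (0 < z.1 < f z.2)%R].
Proof.
move=> mf; rewrite -[X in measurable X]setTI.
apply: (@measurable_and _ _ setT
  (fun z : measurableTypeR R * T => (0 < z.1)%R) (fun z => (z.1 < f z.2)%R)) => //.
- by apply: measurable_fun_ltr => //; exact: measurable_fst.
- apply: measurable_fun_ltr; first exact: measurable_fst.
  by apply: measurableT_comp => //; exact: measurable_snd.
Qed.

Lemma superlevel_measurable (f : T -> R) (t : R) : measurable_fun setT f ->
  measurable [set x | (0 < t < f x)%R].
Proof.
move=> mf; rewrite -[X in measurable X]setTI.
apply: (@measurable_and _ _ setT (fun _ => (0 < t)%R) (fun x => (t < f x)%R)) => //.
by apply: measurable_fun_ltr => //; exact: measurable_cst.
Qed.

(** Tonelli for the indicator of the region under the graph, whose section above [x] is the interval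
    []0, f x[]. *)
Lemma layer_cake (f : T -> R) : measurable_fun setT f -> (forall x, 0 <= f x)%R ->
  measurable_fun [set: measurableTypeR R] (fun t : R => m [set x | (0 < t < f x)%R]) /\
  \int[m]_x (f x)%:E = \int[leb]_t m [set x | (0 < t < f x)%R].
Proof.
move=> mf f0.
pose h := fun z : measurableTypeR R * T =>
  (\1_[set z : measurableTypeR R * T | (0 < z.1 < f z.2)%R] z)%:E : \bar R.
have mh : measurable_fun setT h.
  by apply/measurable_EFinP; apply: measurable_indic; exact: measurable_hypograph.
have h0 z : 0 <= h z by rewrite lee_fin.
have hE t : m [set x | (0 < t < f x)%R] = \int[m]_x h (t, x).
  rewrite -[in LHS](setIT [set x | _]) -integral_indic//.
  exact: superlevel_measurable.
split.
  under eq_fun do rewrite hE.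
  exact: measurable_fun_fubini_tonelli_F.
under [RHS]eq_integral do rewrite hE.
rewrite fubini_tonelli//; apply: eq_integral => x _.
transitivity (leb `]0%R, f x[%classic).
  rewrite lebesgue_measure_itv/= lte_fin; case: ifPn => [_|];
    first by rewrite oppr0 adde0.
  by rewrite -leNgt => fx0; congr EFin; apply/eqP; rewrite eq_le fx0 f0.
by rewrite -[in LHS](setIT `]_, _[%classic) -integral_indic//.
Qed.

End layer_cake.

(** Monotone convergence along truncations; it replaces an extended-valued function by a bounded one
    without losing a strict lower bound on the integral. *)
Lemma integral_min_nat d (T : measurableType d) (R : realType)
    (m : {measure set T -> \bar R}) (u : T -> \bar R) (s : R) :
  measurable_fun setT u -> (forall x, 0 <= u x)%E -> (s%:E < \int[m]_x u x)%E ->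
  exists K : nat, (s%:E < \int[m]_x mine (u x) K%:R%:E)%E.
Proof.
move=> mu u0 su; apply: contrapT => /forallNP H.
move: su; apply/negP; rewrite -leNgt.
have cvgu x : mine (u x) k%:R%:E @[k --> \oo] --> u x.
  have kpinf : (k%:R%:E : \bar R) @[k --> \oo] --> +oo%E.
    by apply/cvgenyP; exact: cvg_id.
  case: (u x) (u0 x) => [r|_|//] r0.
    apply: cvg_near_cst; near=> k; apply/eqP; rewrite min_l//.
    by near: k; exact: (cvgey_ge kpinf).
  have -> : (fun k : nat => mine +oo%E (k%:R%:E : \bar R)) = fun k => k%:R%:E.
    by apply/funext => k; rewrite min_r ?leey.
  exact: kpinf.
rewrite (eq_integral (fun x => limn (fun k => mine (u x) k%:R%:E))); last first.
  by move=> x _; apply/esym/cvg_lim => //; exact: cvgu.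
rewrite monotone_convergence//.
- apply: lime_le.
    apply: ereal_nondecreasing_is_cvgn => i j ij; apply: ge0_le_integral => //.
    + by move=> x _; rewrite le_min u0 lee_fin ler0n.
    + by apply: measurable_mine => //; exact: measurable_cst.
    + by apply: measurable_mine => //; exact: measurable_cst.
    + by move=> x _; rewrite le_min !ge_min lexx/= lee_fin ler_nat ij orbT.
  by apply: nearW => k; rewrite leNgt; apply/negP/H.
- by move=> k; apply: measurable_mine => //; exact: measurable_cst.
- by move=> k x _; rewrite le_min u0 lee_fin ler0n.
- by move=> x _ i j ij; rewrite le_min !ge_min lexx/= lee_fin ler_nat ij orbT.
Unshelve. all: by end_near. Qed.

Section prekopa_leindler.
Context {R : realType}.
Local Notation leb := (@lebesgue_measure R).
Variable l : R.
Hypothesis l01 : 0 < l < 1.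

(** With both suprema equal to [1], the superlevel sets of [u] and [v] are nonempty at exactly the
    same heights, so Brunn-Minkowski applies at every height in []0, 1[], and integrating over the
    height gives the inequality, here with arithmetic rather than geometric means. *)
Lemma prekopa_leindler_normalized (u v w : R -> R) :
  measurable_fun [set: measurableTypeR R] u ->
  measurable_fun [set: measurableTypeR R] v ->
  measurable_fun [set: measurableTypeR R] w ->
  (forall x, 0 <= u x <= 1) -> (forall x, 0 <= v x <= 1) -> (forall x, 0 <= w x) ->
  (forall t, t < 1 -> exists x, t < u x) ->
  (forall t, t < 1 -> exists x, t < v x) ->
  (forall x y t, 0 < t -> t < u x -> t < v y -> t <= w ((1 - l) * x + l * y)) ->
  ((1 - l)%:E * \int[leb]_x (u x)%:E + l%:E * \int[leb]_x (v x)%:E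
     <= \int[leb]_x (w x)%:E)%E.
Proof.
move=> mu mv mw u01 v01 w0 su sv H; have [l0 l1] := andP l01.
have u0 x : 0 <= u x by have /andP[] := u01 x.
have v0 x : 0 <= v x by have /andP[] := v01 x.
have level (t : R) : ((1 - l)%:E * leb [set x | (0 < t < u x)%R] +
    l%:E * leb [set x | (0 < t < v x)%R] <= leb [set x | (0 < t < w x)%R])%E.
  have [t0|] := boolP (t <= 0).
    have lev0 (f : R -> R) : leb [set x | (0 < t < f x)%R] = 0%E.
      by rewrite -(@measure0 _ _ _ leb); congr (leb _); apply/seteqP;
        split => x //= /andP[]; rewrite ltNge t0.
    by rewrite !lev0 !mule0 adde0.
  rewrite -ltNge => t0; have [t1|t1] := leP 1 t.
    have lev0 (f : R -> R) : (forall x, 0 <= f x <= 1) ->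
        [set x | 0 < t < f x] = set0.
      move=> f01; apply/seteqP; split => x //= /andP[_]; have /andP[_ fx] := f01 x.
      by rewrite ltNge (le_trans fx).
    by rewrite (lev0 u)// (lev0 v)// !measure0 !mule0 adde0.
  apply: brunn_minkowski1 => //; try exact: superlevel_measurable.
  - by have [x ?] := su _ t1; exists x; rewrite /= t0.
  - by have [x ?] := sv _ t1; exists x; rewrite /= t0.
  move=> x y /= /andP[_ tu] /andP[_ tv]; rewrite t0/=.
  (* The hypothesis on [w] only yields a weak inequality; applying it at a height strictly between
     [t] and both values gives [t < w]. *)
  pose t' := (t + Num.min (u x) (v y)) / 2.
  have tm : t < Num.min (u x) (v y) by rewrite lt_min tu.
  have m1 : Num.min (u x) (v y) <= u x by rewrite ge_min lexx.
  have m2 : Num.min (u x) (v y) <= v y by rewrite ge_min lexx orbT.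
  by apply: (@lt_le_trans _ _ t'); [|apply: H]; rewrite /t'; lra.
have [mU ->] := layer_cake leb mu u0.
have [mV ->] := layer_cake leb mv v0.
have [mW ->] := layer_cake leb mw w0.
have l'0 : 0 <= 1 - l by rewrite subr_ge0 ltW.
rewrite -[X in (X + _)%E]ge0_integralZl//.
rewrite -[X in (_ + X)%E]ge0_integralZl//; last by rewrite lee_fin ltW.
rewrite -ge0_integralD//; last 4 first.
- by move=> x _; apply: mule_ge0.
- exact: measurable_funeM.
- by move=> x _; apply: mule_ge0 => //; rewrite lee_fin ltW.
- exact: measurable_funeM.
apply: ge0_le_integral => //.
- by move=> x _; apply: adde_ge0; apply: mule_ge0 => //; rewrite lee_fin ltW.
- by apply: emeasurable_funD; exact: measurable_funeM.
move=> t _; exact: level.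
Qed.

(** Weighted AM-GM: the tangent to the exponential at the mean [m] bounds both terms from below, and
    the linear parts cancel. *)
Lemma expR_amgm (a b : R) : expR ((1 - l) * a + l * b) <= (1 - l) * expR a + l * expR b.
Proof.
have [l0 l1] := andP l01; set m := (1 - l) * a + l * b.
have H c : expR m * (1 + (c - m)) <= expR c.
  rewrite [leRHS](_ : _ = expR m * expR (c - m)); last by rewrite -expRD; congr expR;
    ring.
  by rewrite ler_pM2l ?expR_gt0// expR_ge1Dx.
have Ha : (1 - l) * (expR m * (1 + (a - m))) <= (1 - l) * expR a.
  by rewrite ler_pM2l ?subr_gt0.
have Hb : l * (expR m * (1 + (b - m))) <= l * expR b by rewrite ler_pM2l.
apply: le_trans (lerD Ha Hb); rewrite /m le_eqVlt; apply/orP; left; apply/eqP; ring.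
Qed.

(** Truncation makes the supremum finite, and dividing by it makes it [1]. The scale is recorded by
    its logarithm [k], so that the scales of two functions combine into a weighted geometric mean by
    adding exponents. *)
Lemma sup_normalize (u : R -> \bar R) (s : R) :
  measurable_fun [set: measurableTypeR R] u -> (forall x, 0 <= u x)%E ->
  ((expR s)%:E < \int[leb]_x u x)%E ->
  exists u1 : R -> R, exists k : R,
    [/\ measurable_fun [set: measurableTypeR R] u1,
        forall x, 0 <= u1 x <= 1,
        forall x, ((u1 x * expR k)%:E <= u x)%E,
        forall t, t < 1 -> exists x, t < u1 x &
        ((expR (s - k))%:E < \int[leb]_x (u1 x)%:E)%E].
Proof.
move=> mu u0 /(integral_min_nat mu u0)[K sK].
pose uK x := fine (mine (u x) K%:R%:E).
have uKE x : (uK x)%:E = mine (u x) K%:R%:E.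
  by rewrite fineK//; case: (u x) (u0 x) => [r||]//= r0; rewrite /mine; case: ifP.
have muK : measurable_fun [set: measurableTypeR R] uK.
  apply: (measurableT_comp (fine_measurable measurableT)) => //.
  by apply: measurable_mine => //; exact: measurable_cst.
have uK0 x : 0 <= uK x by rewrite -lee_fin uKE le_min u0 lee_fin ler0n.
have uKK x : uK x <= K%:R by rewrite -lee_fin uKE ge_min lexx orbT.
have hs : has_sup (range uK).
  by split; [exists (uK 0), 0|exists K%:R => _ [x _ <-]].
set S := sup (range uK).
have uS x : uK x <= S by apply: (sup_upper_bound hs); exists x.
have {}sK : ((expR s)%:E < \int[leb]_x (uK x)%:E)%E.
  by under eq_integral do rewrite uKE.
have S0 : 0 < S.
  rewrite ltNge; apply/negP => S0; move: sK; apply/negP; rewrite -leNgt.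
  rewrite integral0_eq ?lee_fin ?expR_ge0// => x _; congr EFin.
  by apply/eqP; rewrite eq_le uK0 (le_trans (uS x)).
have Sk : expR (ln S) = S by rewrite lnK// posrE.
exists (fun x => S^-1 * uK x), (ln S); split.
- by apply: measurable_funM => //; exact: measurable_cst.
- by move=> x; rewrite mulr_ge0 ?invr_ge0 ?(ltW S0)// mulrC ler_pdivrMr// mul1r uS.
- move=> x; rewrite Sk mulrAC mulVf ?gt_eqF// mul1r uKE.
  by rewrite ge_min lexx.
- move=> t t1; have e0 : 0 < (1 - t) * S by rewrite mulr_gt0// subr_gt0.
  have [_ [x _ <-] tx] := sup_adherent e0 hs.
  exists x; rewrite mulrC ltr_pdivlMr//; apply: le_lt_trans tx.
  by rewrite -/S; lra.
- under eq_integral do rewrite EFinM.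
  rewrite ge0_integralZl//; last 3 first.
  + exact/measurable_EFinP.
  + by move=> x _; rewrite lee_fin.
  + by rewrite lee_fin invr_ge0 ltW.
  by rewrite expRD expRN Sk mulrC EFinM lte_pmul2l// lte_fin invr_gt0.
Qed.

(* The products [u^(1 - l) v^l] are expressed with strict real lower bounds
   [expR s], [expR t], so that no power of an infinite value is needed, and the
   conclusion for the sections is literally the hypothesis for their integrals. *)
Lemma prekopa_leindler1 (u v w : R -> \bar R) :
  measurable_fun [set: measurableTypeR R] u ->
  measurable_fun [set: measurableTypeR R] v ->
  measurable_fun [set: measurableTypeR R] w ->
  (forall x, 0 <= u x)%E -> (forall x, 0 <= v x)%E -> (forall x, 0 <= w x)%E ->
  (forall x y s t, (expR s)%:E < u x -> (expR t)%:E < v y ->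
    (expR ((1 - l) * s + l * t))%:E <= w ((1 - l) * x + l * y)%R)%E ->
  forall s t, ((expR s)%:E < \int[leb]_x u x -> (expR t)%:E < \int[leb]_x v x ->
    (expR ((1 - l) * s + l * t))%:E <= \int[leb]_x w x)%E.
Proof.
move=> mu mv mw u0 v0 w0 H s t; have [l0 l1] := andP l01.
move=> /(sup_normalize mu u0)[u1 [m [mu1 u101 u1u su1 su]]].
move=> /(sup_normalize mv v0)[v1 [n [mv1 v101 v1v sv1 sv]]].
(* [e^q] is the geometric mean of the scales of [u] and [v]. Capping [w] there makes it real-valued
   and costs nothing: the levels [r] of the normalized functions are at most [1], so only lower
   bounds [r e^q <= e^q] are ever asked of [w]. *)
pose q := (1 - l) * m + l * n.
pose wq x := fine (mine (w x) (expR q)%:E).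
have wqE x : (wq x)%:E = mine (w x) (expR q)%:E.
  by rewrite fineK//; case: (w x) (w0 x) => [r||]//= r0; rewrite /mine; case: ifP.
have mwq : measurable_fun [set: measurableTypeR R] wq.
  apply: (measurableT_comp (fine_measurable measurableT)) => //.
  by apply: measurable_mine => //; exact: measurable_cst.
have wq0 x : 0 <= wq x by rewrite -lee_fin wqE le_min w0 lee_fin expR_ge0.
have := @prekopa_leindler_normalized u1 v1 (fun x => expR (- q) * wq x) mu1 mv1.
move=> /(_ (measurable_funM (measurable_cst _) mwq) u101 v101).
move=> /(_ (fun x => mulr_ge0 (expR_ge0 _) (wq0 x)) su1 sv1).
have Hw x y r : 0 < r -> r < u1 x -> r < v1 y ->
    r <= expR (- q) * wq ((1 - l) * x + l * y).
  move=> r0 ru rv; rewrite expRN mulrC ler_pdivlMr ?expR_gt0// -lee_fin wqE le_min.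
  rewrite lee_fin ger_pMl ?expR_gt0// andbC.
  have r1 : r <= 1 by have /andP[_] := u101 x; apply: le_trans; exact: ltW.
  rewrite r1/=.
  have rE : r = expR (ln r) by rewrite lnK// posrE.
  have -> : r * expR q = expR ((1 - l) * (ln r + m) + l * (ln r + n)).
    by rewrite {1}rE -expRD; congr expR; rewrite /q; ring.
  apply: H; rewrite expRD -rE.
    by apply: lt_le_trans (u1u x); rewrite lte_fin ltr_pM2r ?expR_gt0.
  by apply: lt_le_trans (v1v y); rewrite lte_fin ltr_pM2r ?expR_gt0.
move=> /(_ Hw) PL.
have wqw : (\int[leb]_x (expR (- q) * wq x)%:E <= (expR (- q))%:E * \int[leb]_x w x)%E.
  under eq_integral do rewrite EFinM.
  rewrite ge0_integralZl//; last 2 first.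
  - exact/measurable_EFinP.
  - by move=> x _; rewrite lee_fin.
  rewrite lee_wpmul2l ?lee_fin ?expR_ge0//; apply: ge0_le_integral => //.
  - by move=> x _; rewrite lee_fin.
  - exact/measurable_EFinP.
  - by move=> x _; rewrite wqE ge_min lexx.
have -> : (1 - l) * s + l * t = q + ((1 - l) * (s - m) + l * (t - n)).
  by rewrite /q; ring.
rewrite expRD EFinM -lee_pdivlMl ?expR_gt0// -expRN; apply: le_trans wqw.
apply: le_trans PL; apply: (@le_trans _ _ ((1 - l) * expR (s - m) + l * expR (t -
  n))%:E).
  by rewrite lee_fin expR_amgm.
by rewrite EFinD !EFinM; apply: leeD; apply: lee_wpmul2l;
  rewrite ?lee_fin ?subr_ge0 ?(ltW l0) ?(ltW l1) ?(ltW su) ?(ltW sv).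
Qed.

End prekopa_leindler.

(** * Prekopa-Leindler in R^n *)

Section lebesgue_rV_theory.
Context {R : realType}.
Local Notation leb := (@lebesgue_measure R).

Lemma integral_rV0 (f : 'rV[R]_0 -> \bar R) :
  measurable_fun setT f -> (\int[lebesgue_rV 0]_x f x = f 0%R)%E.
Proof. by move=> mf; rewrite integral_dirac// diracT mul1e. Qed.

Lemma measurable_section_rV n (f : 'rV[R]_n.+1 -> \bar R) (x : R) :
  measurable_fun setT f -> measurable_fun setT (fun v => f (glue_rV (x, v))).
Proof.
move=> mf; apply: (measurableT_comp mf).
apply: (measurableT_comp (@measurable_glue_rV _ n)).
exact: measurable_pair1.
Qed.

Lemma measurable_integral_section_rV n (f : 'rV[R]_n.+1 -> \bar R) :
  measurable_fun setT f -> (forall z, (0 <= f z)%E) ->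
  measurable_fun [set: measurableTypeR R]
    (fun x : R => \int[lebesgue_rV n]_v f (glue_rV (x, v)))%E.
Proof.
move=> mf f0.
apply: (@measurable_fun_fubini_tonelli_F _ _ (measurableTypeR R) _ R
  (lebesgue_rV n) (f \o @glue_rV R n)) => //.
  by apply: (measurableT_comp mf); exact: measurable_glue_rV.
by move=> z; exact: f0.
Qed.

Lemma glue_rV_scaleD n (a b x y : R) (u v : 'rV[R]_n) :
  a *: glue_rV (x, u) + b *: glue_rV (y, v) =
  glue_rV (a * x + b * y, a *: u + b *: v).
Proof.
apply/rowP => i; rewrite [LHS]mxE ![(_ *: glue_rV _) _ _]mxE.
case: (unliftP ord0 i) => [j ->|->]; last by rewrite !glue_rV0.
by rewrite !glue_rVS /= !mxE.
Qed.

Lemma prekopa_leindler (l : R) n (u v w : 'rV[R]_n -> \bar R) : 0 < l < 1 ->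
  measurable_fun setT u -> measurable_fun setT v -> measurable_fun setT w ->
  (forall x, 0 <= u x)%E -> (forall x, 0 <= v x)%E -> (forall x, 0 <= w x)%E ->
  (forall x y s t, (expR s)%:E < u x -> (expR t)%:E < v y ->
    (expR ((1 - l) * s + l * t))%:E <= w ((1 - l) *: x + l *: y)%R)%E ->
  forall s t, ((expR s)%:E < \int[lebesgue_rV n]_x u x ->
    (expR t)%:E < \int[lebesgue_rV n]_x v x ->
    (expR ((1 - l) * s + l * t))%:E <= \int[lebesgue_rV n]_x w x)%E.
Proof.
move=> l01; elim: n u v w => [|n IH] u v w mu mv mw u0 v0 w0 H s t.
  rewrite !integral_rV0// => su tv; have := H _ _ _ _ su tv.
  by rewrite !scaler0 addr0.
rewrite !ge0_integral_rVS//.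
apply: prekopa_leindler1 => //; try exact: measurable_integral_section_rV.
- by move=> x; exact: integral_ge0.
- by move=> x; exact: integral_ge0.
- by move=> x; exact: integral_ge0.
move=> x y s' t'; apply: IH => //; try exact: measurable_section_rV.
by move=> x' y' s'' t'' su tv; rewrite -glue_rV_scaleD; exact: H.
Qed.

Lemma measurable_reflect_rV n (c : 'rV[R]_n) :
  measurable_fun setT (fun x : 'rV[R]_n => c - x).
Proof.
apply/measurable_fun_rVP => i; under eq_fun do rewrite !mxE.
by apply: measurable_funB => //; exact: measurable_coor.
Qed.

(** One coordinate at a time, by slicing. It provides the symmetry of a Gaussian about its mean. *)
Lemma ge0_integral_rV_reflect n (c : 'rV[R]_n) (f : 'rV[R]_n -> \bar R) :
  measurable_fun setT f -> (forall x, 0 <= f x)%E ->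
  (\int[lebesgue_rV n]_x f (c - x)%R = \int[lebesgue_rV n]_x f x)%E.
Proof.
elim: n c f => [|n IH] c f mf f0.
  rewrite !integral_rV0//; last by apply: (measurableT_comp mf);
    apply/measurable_fun_rVP => -[].
  by congr f; apply/rowP => -[].
rewrite ge0_integral_rVS//; last first.
  exact: (measurableT_comp mf (measurable_reflect_rV c)).
rewrite [RHS]ge0_integral_rVS//.
rewrite -[RHS](ge0_integral_reflect (c ord0 ord0)); last 2 first.
- exact: measurable_integral_section_rV.
- by move=> x; exact: integral_ge0.
apply: eq_integral => x _.
rewrite -[RHS](IH (\row_i c ord0 (lift ord0 i))); last 2 first.
- exact: measurable_section_rV.
- by move=> ?; exact: f0.
apply: eq_integral => v _; congr f; apply/rowP => i.
case: (unliftP ord0 i) => [j ->|->].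
  by rewrite glue_rVS [LHS]mxE [X in _ + X]mxE glue_rVS /= !mxE.
by rewrite glue_rV0 [LHS]mxE [X in _ + X]mxE glue_rV0.
Qed.

End lebesgue_rV_theory.

(** The sigma-algebra is generated by the coordinates, not by the open sets of the norm. Rounding
    [x] down to the grid of mesh [1 / (k + 1)] gives functions that are constant on countably many
    measurable boxes, and they converge to [f] by continuity. *)
Lemma measurable_continuous_rV (R : realType) n (f : 'rV[R]_n -> R) :
  continuous f -> measurable_fun setT f.
Proof.
move=> cf.
pose r k (q : 'rV[int]_n) : 'rV[R]_n := \row_i ((q ord0 i)%:~R / k.+1%:R).
pose fl k (x : 'rV[R]_n) : 'rV[int]_n := \row_i Num.floor (k.+1%:R * x ord0 i).
apply: (@measurable_fun_cvg _ _ R setT (fun k x => f (r k (fl k x)))).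
  move=> k _ Y mY; rewrite setTI.
  rewrite (_ : _ @^-1` Y = \bigcup_q ([set x | Y (f (r k q))] `&`
    [set x : 'rV[R]_n | forall i, [set y | Num.floor (k.+1%:R * y) = q ord0 i] (x ord0
      i)])).
    apply: (@countable_bigcupT_measurable _ 'rV[R]_n 'rV[int]_n) => [|q];
      first exact: countableP.
    apply: measurableI.
      have [H|H] := pselect (Y (f (r k q))).
        by rewrite (_ : [set _ | _] = setT)//; apply/seteqP; split.
      by rewrite (_ : [set _ | _] = set0)//; apply/seteqP; split.
    apply: (@measurable_box_rV _ R n (fun i => [set y | Num.floor (k.+1%:R * y) = q
      ord0 i])) => i.
    rewrite (_ : [set y | _] = `[(q ord0 i)%:~R / k.+1%:R, ((q ord0 i) + 1)%:~R /
      k.+1%:R[%classic); last first.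
      apply/seteqP; split => y /=; rewrite in_itv/= ler_pdivrMr// ltr_pdivlMr// mulrC.
        by move=> <-; rewrite floor_itv ?num_real.
      by move=> /floor_def.
    exact: measurable_itv.
  apply/seteqP; split => [x Yx|x [q _ [/= Yq xq]]] /=.
    by exists (fl k x) => //; split => //= i; rewrite mxE.
  by rewrite (_ : fl k x = q)//; apply/rowP => i; rewrite mxE; exact: xq.
move=> x _; apply: continuous_cvg; first exact: cf.
apply/cvgrPdist_le => e e0; near=> k.
have ke : k.+1%:R^-1 <= e by apply: ltW; near: k;
  exact: near_infty_natSinv_lt (PosNum e0).
rewrite /Num.norm/= mx_normrE; apply: bigmax_le => [|[i j] _ /=]; first exact: ltW.
rewrite !mxE ord1; apply: le_trans ke; set y := x ord0 j.
have /andP[y1 y2] := floor_itv (k.+1%:R * y).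
rewrite -(@ler_pM2l _ k.+1%:R)// divff// -[X in X * _]gtr0_norm// -normrM mulrBr.
rewrite mulrCA divff// mulr1 ger0_norm ?subr_ge0// lerBlDl -[1]/(1%:~R) -intrD ltW//.
Unshelve. all: by end_near. Qed.

(** * Strong convexity from the Hessian *)

Section strong_convexity.
Context {R : realType} {n : nat}.
Implicit Types (V : 'rV[R]_n -> R) (x d : 'rV[R]_n).

Let line_quotient (W : normedModType R) (F : 'rV[R]_n -> W) x d (t : R) :
  (fun h : R => h^-1 *: (((fun s : R => F (x + s *: d)) \o shift t) (h *: (1 : R^o))
    - F (x + t *: d))) =
  (fun h : R => h^-1 *: ((F \o shift (x + t *: d)) (h *: d) - F (x + t *: d))).
Proof.
apply/funext => h /=; congr (_ *: (F _ - _)).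
by rewrite scalerDl [h *: 1]mulr1 addrCA.
Qed.

Lemma derivable_line (W : normedModType R) (F : 'rV[R]_n -> W) x d (t : R) :
  derivable F (x + t *: d) d -> derivable (fun s : R => F (x + s *: d)) t 1.
Proof.
by rewrite /derivable -line_quotient.
Qed.

Lemma derive_line (W : normedModType R) (F : 'rV[R]_n -> W) x d (t : R) :
  'D_1 (fun s : R => F (x + s *: d)) t = 'D_d F (x + t *: d).
Proof. by rewrite /derive line_quotient. Qed.

Lemma derive_gradient V x d : differentiable V x ->
  'D_d V x = \sum_i d ord0 i * gradient V x ord0 i.
Proof.
move=> dV; rewrite deriveE// [in LHS](row_sum_delta d) linear_sum/=.
by apply: eq_bigr => i _; rewrite linearZ/= mxE deriveE.
Qed.

(** On the segment, [F t = V (x + t d) - (mu / 2) |d|^2 t^2] has second derivative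
    [d H d^T - mu |d|^2 >= 0], hence is convex on [[0, 1]]; the subtracted square contributes the
    difference between [l] and [l^2], which is the factor [l (1 - l)]. *)
Lemma strong_convexity (mu : R) V : twice_differentiable V ->
  (forall x, loewner_le mu%:M (hessian V x)) ->
  forall (x y : 'rV[R]_n) (l : R), 0 <= l <= 1 ->
  V ((1 - l) *: x + l *: y) <=
    (1 - l) * V x + l * V y - mu / 2 * (l * (1 - l)) * sqnorm (y - x).
Proof.
move=> [dV dG] H x y l l01; set d := y - x; set k := mu / 2 * sqnorm d.
pose f (t : R) := V (x + t *: d).
pose g (t : R) := \sum_i d ord0 i * gradient V (x + t *: d) ord0 i.
have fD t : is_derive (t : R^o) (1 : R^o) (f : R^o -> R^o) (g t).
  apply: DeriveDef; first by apply: derivable_line; exact: diff_derivable.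
  by rewrite derive_line derive_gradient.
have gD t : is_derive (t : R^o) (1 : R^o) (g : R^o -> R^o) ((d *m hessian V (x + t *:
  d) *m d^T) ord0 ord0).
  rewrite mxE /g.
  rewrite (_ : (fun t => _) = \sum_i (fun t : R => d ord0 i * gradient V (x + t *: d)
    ord0 i)); last first.
    by apply/funext => s; rewrite fct_sumE.
  apply: is_derive_sum => i.
  have dGt : derivable (fun s : R => gradient V (x + s *: d)) t 1.
    by apply: derivable_line; exact: diff_derivable.
  have dGi : is_derive t 1 (fun s : R => gradient V (x + s *: d) ord0 i) ((d *m
    hessian V (x + t *: d)) ord0 i).
    apply: DeriveDef; first exact: ((derivable_mxP _ _ _).1 dGt).
    rewrite -deriveEjacobian// -derive_line derive_mx// mxE.
    by [].
  by rewrite [d^T _ _]mxE mulrC; exact: (is_deriveZ (d ord0 i) dGi).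
pose F : R^o -> R^o := (f : R^o -> R^o) - (k \*: ((@idfun R^o) ^+ 2)).
have FE t : F t = f t - k * t ^+ 2 by [].
pose F1 : R^o -> R^o := (g : R^o -> R^o) - ((2 * k) \*: @idfun R^o).
have FD (t : R^o) : is_derive t (1 : R^o) F (F1 t).
  apply: is_derive_eq.
  rewrite /F1/= -[in RHS]/(g t - _).
  rewrite -[LHS]/(g t - k * (2%:R * t ^+ 1 * 1)) -[X in _ = _ - X]/(2 * k * t).
  by ring.
have DF : 'D_1 F = F1 by apply/funext => t; exact: derive_val.
have F1D (t : R^o) : is_derive t (1 : R^o) F1
    ((d *m hessian V (x + (t : R) *: d) *m d^T) ord0 ord0 - (2 * k)).
  apply: is_derive_eq.
  by rewrite -[LHS]/((d *m hessian V (x + (t : R) *: d) *m d^T) ord0 ord0 - 2 * k * 1)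
    mulr1.
have cF (t : R^o) : {for t, continuous F}.
  by apply: differentiable_continuous; apply/derivable1_diffP; exact: ex_derive.
have l'01 : 0 <= 1 - l <= 1 by case/andP: l01 => *; apply/andP; split; lra.
have FDD (t : R^o) : 'D_1 ('D_1 F) t =
    (d *m hessian V (x + (t : R) *: d) *m d^T) ord0 ord0 - 2 * k.
  by rewrite DF; exact: derive_val.
have FDD0 (t : R^o) : 0 <= 'D_1 ('D_1 F) t.
  rewrite FDD subr_ge0; apply: le_trans (H (x + (t : R) *: d) d).
  rewrite mul_mx_scalar -scalemxAl mxE -[X in 2 * X]/(mu / 2 * sqnorm d).
  rewrite mulrA [2 * _]mulrC divfK// le_eqVlt; apply/orP; left; apply/eqP.
  by congr (_ * _); rewrite /sqnorm mxE; apply: eq_bigr => i _;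
    rewrite [d^T _ _]mxE expr2.
have := @second_derivative_convex R F 0 1 (fun t _ => FDD0 t) _ _ _ _
  (Itv01 (andP l'01).1 (andP l'01).2) ler01.
move=> /(_ _ _ _ _)/wrap[].
- by apply: cvg_at_left_filter; exact: cF.
- by apply: cvg_at_right_filter; exact: cF.
- by move=> t _; exact: ex_derive.
- by move=> t _; rewrite DF; exact: ex_derive.
rewrite !convRE/= /unstable.onem mulr0 add0r mulr1 !FE subKr /f scale0r addr0 scale1r.
have -> : x + d = y by rewrite /d addrC subrK.
rewrite (_ : x + l *: d = (1 - l) *: x + l *: y); last first.
  by rewrite /d scalerBr scalerBl scale1r addrA addrAC.
by rewrite expr0n/= expr1n mulr0 subr0 mulr1 /k => Fl; nra.
Qed.

End strong_convexity.

(** * Integration against densities *)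

Section integral_density.
Context d (T : measurableType d) (R : realType).
Variables m m' : {measure set T -> \bar R}.
Variable w : T -> R.
Hypotheses (mw : measurable_fun setT w) (w0 : forall x, 0 <= w x).
Local Open Scope ereal_scope.
Hypothesis m'E : forall A, measurable A -> m' A = \int[m]_(x in A) (w x)%:E.

Import HBNNSimple.

(** From sets to simple functions to monotone limits. It serves for [nu] against [e^-V], for the
    Gaussian kernel and for the tilt, each known through its values on sets. *)
Lemma integral_density (f : T -> \bar R) :
  measurable_fun setT f -> (forall x, 0 <= f x) ->
  \int[m']_x f x = \int[m]_x ((w x)%:E * f x).
Proof.
move=> mf f0; pose h := nnsfun_approx measurableT mf.
have -> : \int[m']_x f x = limn (fun n => \int[m']_x (h n x)%:E).
  rewrite -monotone_convergence//.
  - apply: eq_integral => x _; apply/esym/cvg_lim => //.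
    exact: cvg_nnsfun_approx.
  - by move=> n; exact/measurable_EFinP.
  - by move=> n x _; rewrite lee_fin.
  - by move=> x _ a b ab; rewrite lee_fin; exact/lefP/nd_nnsfun_approx.
have -> : \int[m]_x ((w x)%:E * f x) =
    limn (fun n => \int[m]_x ((w x)%:E * (h n x)%:E)).
  rewrite -monotone_convergence//.
  - apply: eq_integral => x _; apply/esym/cvg_lim => //.
    by apply: cvgeZl => //; exact: cvg_nnsfun_approx.
  - move=> n; apply: emeasurable_funM; exact/measurable_EFinP.
  - by move=> n x _; rewrite mule_ge0 ?lee_fin.
  - move=> x _ a b ab; rewrite lee_wpmul2l ?lee_fin//.
    exact/lefP/nd_nnsfun_approx.
congr (limn _); apply/funext => n.
under eq_integral do rewrite fimfunE -fsumEFin//.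
rewrite ge0_integral_fsum//; last 2 first.
- by move=> r; exact/measurable_EFinP/measurableT_comp.
- by move=> r z _; rewrite EFinM nnfun_muleindic_ge0.
under [RHS]eq_integral => x _.
  rewrite fimfunE -fsumEFin// ge0_mule_fsumr; last first.
    by move=> r; exact: nnfun_muleindic_ge0.
  over.
rewrite ge0_integral_fsum//; last 2 first.
- move=> r; apply: emeasurable_funM; first exact/measurable_EFinP.
  exact/measurable_EFinP/measurableT_comp.
- by move=> r z _; apply: mule_ge0; [rewrite lee_fin|exact: nnfun_muleindic_ge0].
apply: eq_fsbigr => r _.
rewrite (integralZl_indic _ (fun r => h n @^-1` [set r]))//; last first.
  by move=> r0; rewrite preimage_nnfun0.
rewrite integral_indic// setIT m'E//.
have [r0|r0] := leP 0%R r; last first.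
  rewrite preimage_nnfun0// integral_set0 mule0 integral0_eq// => x _.
  by rewrite indic0 mulr0 mule0.
under [RHS]eq_integral do rewrite EFinM muleCA.
rewrite ge0_integralZl//.
- congr (_ * _); rewrite integral_mkcond; apply: eq_integral => x _.
  by rewrite epatch_indic/=.
- apply: emeasurable_funM; first exact/measurable_EFinP.
  by apply/measurable_EFinP; exact: measurable_indic.
- by move=> x _; rewrite mule_ge0 ?lee_fin.
Qed.

End integral_density.

(** Jensen through the tangent at the mean: [e^m (1 + f) <= e^f + m e^m]. Written with this shift,
    all integrands are nonnegative, and the integral of [e^f] may be infinite. *)
Lemma expR_integral_le d (T : measurableType d) (R : realType)
    (P : {measure set T -> \bar R}) (f : T -> R) (m : R) :
  P setT = 1%E -> measurable_fun setT f -> (forall x, 0 <= f x) ->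
  (\int[P]_x (f x)%:E = m%:E)%E ->
  ((expR m)%:E <= \int[P]_x (expR (f x))%:E)%E.
Proof.
move=> P1 mf f0 fm.
have m0 : 0 <= m by rewrite -lee_fin -fm; apply: integral_ge0 => x _; rewrite lee_fin.
have me : measurable_fun setT (fun x => expR (f x)).
  by apply: measurableT_comp.
rewrite -(@leeD2rE _ (m * expR m)%:E)//.
have -> : ((m * expR m)%:E = \int[P]_x (m * expR m)%:E)%E.
  by rewrite integral_cst// P1 mule1.
have m1 : measurable_fun setT (fun x => 1 + (f x)%:E)%E.
  by apply: emeasurable_funD => //; exact/measurable_EFinP.
have p1 x : (0 <= 1 + (f x)%:E)%E by rewrite adde_ge0// lee_fin.
rewrite -ge0_integralD//; last 2 first.
- exact/measurable_EFinP.
- by move=> x _; rewrite lee_fin mulr_ge0// expR_ge0.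
apply: (@le_trans _ _ (\int[P]_x ((expR m)%:E * (1 + (f x)%:E)))%E).
  rewrite ge0_integralZl// ?lee_fin ?expR_ge0// ge0_integralD//; last 2 first.
  - by move=> x _; rewrite lee_fin.
  - exact/measurable_EFinP.
  rewrite fm !integral_cst// P1 !mule1 -(EFinD 1) -(EFinM (expR m)) -EFinD lee_fin.
  by rewrite mulrDr mulr1 [m * _]mulrC.
apply: ge0_le_integral => //.
- by move=> x _; rewrite mule_ge0// lee_fin expR_ge0.
- exact: measurable_funeM.
- by apply/measurable_EFinP; apply: measurable_funD.
move=> x _; rewrite -EFinD -EFinM lee_fin.
have : expR m * (1 + (f x - m)) <= expR m * expR (f x - m).
  by rewrite ler_pM2l ?expR_gt0// expR_ge1Dx.
by rewrite -expRD [m + _]addrC subrK; lra.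
Qed.

(** * Reversibility of the dynamics *)

Section restricted_gaussian_kernel.
Context {R : realType} {n : nat}.
Variables (eta : R) (nu : probability 'rV[R]_n R).
Hypothesis eta0 : 0 < eta.
Local Notation T := 'rV[R]_n.
Local Notation lebn := (lebesgue_rV n).
Local Open Scope ereal_scope.

Lemma gaussian_weightC (x y : T) :
  gaussian_weight eta (x, y) = gaussian_weight eta (y, x).
Proof.
rewrite /gaussian_weight/=; congr (expR (_ * _)); apply: eq_bigr => i _.
by rewrite !mxE -sqrrN opprB.
Qed.

Lemma measurable_gaussian_weightr (y : T) :
  measurable_fun setT (fun x => gaussian_weight eta (y, x)).
Proof. exact: measurableT_comp (measurable_gaussian_weight eta) _. Qed.

Lemma measurable_gaussian_pdfr (x : T) :
  measurable_fun setT (fun y => gaussian_pdf eta (x, y)).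
Proof. exact: measurableT_comp (measurable_gaussian_pdf eta) _. Qed.

Lemma integral_gaussian_kernel (x : T) (f : T -> \bar R) :
  measurable_fun setT f -> (forall y, 0 <= f y) ->
  \int[gaussian_kernel eta x]_y f y =
  \int[lebn]_y ((gaussian_pdf eta (x, y))%:E * f y).
Proof.
move=> mf f0; apply: integral_density => //.
- exact: measurable_gaussian_pdfr.
- by move=> y; exact: gaussian_pdf_ge0.
Qed.

Let Z (y : T) := \int[nu]_x (gaussian_weight eta (y, x))%:E.

Lemma integral_tilt (y : T) (f : T -> \bar R) :
  measurable_fun setT f -> (forall x, 0 <= f x) ->
  \int[tilt eta nu y]_x f x =
  (fine (Z y))^-1%:E * \int[nu]_x ((gaussian_weight eta (y, x))%:E * f x).
Proof.
move=> mf f0.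
have mw := measurable_gaussian_weightr y.
have w0 x : (0 <= gaussian_weight eta (y, x))%R by exact: gaussian_weight_ge0.
have tiltT : tilt eta nu y setT = 1 by exact: prob_kernel.
(* A normalizing integral equal to [0] or [+oo] would, by the conventions for quotients, give total
   mass [0], contradicting [tiltT]. *)
have ZV : (Z y)^-1 = ((fine (Z y))^-1)%:E.
  move: tiltT; rewrite tiltE// -/(Z y); case: (Z y) => [r||] /=.
  - by rewrite inver; case: eqP => // ->; rewrite mul0e => -[/eqP];
      rewrite eq_sym oner_eq0.
  - by rewrite invey (mule0 (+oo : \bar R)) => /esym/eqP; rewrite onee_eq0.
  - by rewrite inveNy.
have fZ0 : (0 <= (fine (Z y))^-1)%R.
  by rewrite invr_ge0 fine_ge0//; apply: integral_ge0 => x _; rewrite lee_fin.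
rewrite (@integral_density _ _ _ nu _ (fun x => (fine (Z y))^-1 * gaussian_weight eta
  (y, x))%R)//.
- under eq_integral do rewrite EFinM -muleA.
  rewrite ge0_integralZl//; last by move=> x _; rewrite mule_ge0// lee_fin.
  by apply: emeasurable_funM => //; exact/measurable_EFinP.
- exact: measurable_funM.
- by move=> x; rewrite mulr_ge0.
- move=> A mA; rewrite tiltE// -/(Z y) ZV muleC -ge0_integralZl//.
  + exact/measurable_EFinP/measurable_funTS.
  + by move=> x _; rewrite lee_fin.
Qed.

Lemma integral_rgd (x : T) (f : T -> \bar R) :
  measurable_fun setT f -> (forall y, 0 <= f y) ->
  \int[rgd eta nu x]_z f z =
  \int[gaussian_kernel eta x]_y \int[tilt eta nu y]_z f z.
Proof.
move=> mf f0.
by rewrite -(@integral_kcomp _ _ _ _ _ _ _ (gaussian_kernel eta) (kernel.kernel_snd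
  (tilt eta nu)) x f f0 mf).
Qed.

Lemma measurable_integral_tilt (f : T -> \bar R) :
  measurable_fun setT f -> (forall x, 0 <= f x) ->
  measurable_fun setT (fun y => \int[tilt eta nu y]_x f x).
Proof.
move=> mf f0; apply: measurable_fun_integral_kernel => //.
exact: measurable_kernel.
Qed.

Lemma measurable_integral_gaussian (f : T -> \bar R) :
  measurable_fun setT f -> (forall x, 0 <= f x) ->
  measurable_fun setT (fun y => \int[gaussian_kernel eta y]_x f x).
Proof.
move=> mf f0; apply: measurable_fun_integral_kernel => //.
exact: measurable_kernel.
Qed.

Lemma measurable_integral_rgd (f : T -> \bar R) :
  measurable_fun setT f -> (forall x, 0 <= f x) ->
  measurable_fun setT (fun y => \int[rgd eta nu y]_x f x).
Proof.
move=> mf f0; apply: measurable_fun_integral_kernel => //.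
exact: measurable_kernel.
Qed.

(** Integrating last over the intermediate point [y] makes the form visibly symmetric in [f] and
    [g]: given [y], both endpoints of a step are weighted by the same Gaussian factor against
    [nu]. *)
Let rgd_form (f g : T -> \bar R) :
  measurable_fun setT f -> (forall x, 0 <= f x) ->
  measurable_fun setT g -> (forall x, 0 <= g x) ->
  \int[nu]_x ((\int[rgd eta nu x]_z f z) * g x) =
  \int[lebn]_y (((Num.sqrt (2 * pi * eta) ^+ n)^-1%:E * (fine (Z y))^-1%:E) *
    ((\int[nu]_x ((gaussian_weight eta (y, x))%:E * f x)) *
     (\int[nu]_x ((gaussian_weight eta (y, x))%:E * g x)))).
Proof.
move=> mf f0 mg g0.
pose S y := \int[tilt eta nu y]_x f x.
have S0 y : 0 <= S y by exact: integral_ge0.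
have mS : measurable_fun setT S by exact: measurable_integral_tilt.
have mpdf : measurable_fun setT (fun z : T * T => (gaussian_pdf eta (z.1, z.2))%:E).
  by apply/measurable_EFinP; under eq_fun do rewrite -surjective_pairing;
    exact: measurable_gaussian_pdf.
transitivity (\int[nu]_x \int[lebn]_y ((gaussian_pdf eta (x, y))%:E * S y * g x)).
  apply: eq_integral => x _; rewrite integral_rgd// integral_gaussian_kernel//.
  rewrite ge0_integralZr//.
  - apply: emeasurable_funM => //; apply/measurable_EFinP.
    exact: measurable_gaussian_pdfr.
  - by move=> y _; rewrite mule_ge0 ?S0// lee_fin gaussian_pdf_ge0.
rewrite (@fubini_tonelli _ _ T T R nu lebn
  (fun z => (gaussian_pdf eta (z.1, z.2))%:E * S z.2 * g z.1))/=; last 2 first.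
- apply: emeasurable_funM; last exact: (measurableT_comp mg measurable_fst).
  by apply: emeasurable_funM; [exact: mpdf|exact: (measurableT_comp mS measurable_snd)].
- by move=> z; rewrite !mule_ge0 ?S0 ?g0// lee_fin gaussian_pdf_ge0.
apply: eq_integral => y _.
rewrite (eq_integral (fun x => ((Num.sqrt (2 * pi * eta) ^+ n)^-1%:E * S y) *
    ((gaussian_weight eta (y, x))%:E * g x))); last first.
  move=> x _; rewrite gaussian_pdfE// EFinM gaussian_weightC.
  by rewrite -!muleA; congr (_ * _); rewrite muleCA.
rewrite ge0_integralZl//.
- by rewrite /S integral_tilt// !muleA.
- apply: emeasurable_funM => //; apply/measurable_EFinP.
  exact: measurable_gaussian_weightr.
- by move=> x _; rewrite mule_ge0// lee_fin gaussian_weight_ge0.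
- by rewrite mule_ge0// lee_fin invr_ge0 exprn_ge0// sqrtr_ge0.
Qed.

Lemma rgd_reversible (f g : T -> \bar R) :
  measurable_fun setT f -> (forall x, 0 <= f x) ->
  measurable_fun setT g -> (forall x, 0 <= g x) ->
  \int[nu]_x ((\int[rgd eta nu x]_z f z) * g x) =
  \int[nu]_x (f x * \int[rgd eta nu x]_z g z).
Proof.
move=> mf f0 mg g0; rewrite rgd_form//.
under [RHS]eq_integral do rewrite muleC.
rewrite rgd_form//; apply: eq_integral => y _; congr (_ * _); exact: muleC.
Qed.

Lemma integral_rgd_stationary (f : T -> \bar R) :
  measurable_fun setT f -> (forall x, 0 <= f x) ->
  \int[nu]_x (\int[rgd eta nu x]_z f z) = \int[nu]_x f x.
Proof.
move=> mf f0; have := @rgd_reversible f (cst 1) mf f0 (measurable_cst _) (fun=> lee01).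
under eq_integral do rewrite mule1.
move=> ->; apply: eq_integral => x _.
by rewrite integral_cst// prob_kernel mul1e mule1.
Qed.

End restricted_gaussian_kernel.

(** * The Gaussian kernel under a change of mean *)

Section gaussian_shift.
Context {R : realType} {n : nat}.
Variable eta : R.
Hypothesis eta0 : 0 < eta.
Local Notation T := 'rV[R]_n.
Local Notation lebn := (lebesgue_rV n).

Lemma gaussian_pdf_reflect (a y : T) :
  gaussian_pdf eta (a, a + a - y) = gaussian_pdf eta (a, y).
Proof.
rewrite !gaussian_pdfE//; congr (_ * expR (_ * _)).
by apply: eq_bigr => i _; rewrite !mxE/= -[RHS]sqrrN; congr (_ ^+ 2); ring.
Qed.

Lemma integral_gaussian_reflect (a : T) (f : T -> \bar R) :
  measurable_fun setT f -> (forall y, 0 <= f y)%E ->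
  (\int[gaussian_kernel eta a]_y f (a + a - y)%R = \int[gaussian_kernel eta a]_y f y)%E.
Proof.
move=> mf f0; rewrite !integral_gaussian_kernel//; last first.
  by apply: (measurableT_comp mf); exact: measurable_reflect_rV.
rewrite -[RHS](ge0_integral_rV_reflect (a + a)).
- by apply: eq_integral => y _; rewrite gaussian_pdf_reflect.
- by apply: emeasurable_funM => //; apply/measurable_EFinP;
    exact: measurable_gaussian_pdfr.
- by move=> y; rewrite mule_ge0// lee_fin gaussian_pdf_ge0.
Qed.

(** Expanding [|y - z|^2] about [a], the logarithm of the density ratio of [N(z, eta Id)] to
    [N(a, eta Id)] is this term, linear in [y - a], minus the constant [|z - a|^2 / (2 eta)]. *)
Let tiltf (a z y : T) : R := eta^-1 * \sum_i (y ord0 i - a ord0 i) * (z ord0 i - a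
  ord0 i).

Let measurable_tiltf a z : measurable_fun setT (tiltf a z).
Proof.
apply: measurable_funM; first exact: measurable_cst.
apply: measurable_sum => i; apply: measurable_funM; last exact: measurable_cst.
by apply: measurable_funB; [exact: measurable_coor|exact: measurable_cst].
Qed.

Let gaussian_pdf_shift (a z y : T) :
  gaussian_pdf eta (z, y) =
  gaussian_pdf eta (a, y) * expR (tiltf a z y) * expR (- (2 * eta)^-1 * sqnorm (z - a)).
Proof.
rewrite !gaussian_pdfE// -!mulrA; congr (_ * _).
rewrite /gaussian_weight/= -!expRD; congr expR.
rewrite /sqnorm /tiltf !mulr_sumr -!big_split/=; apply: eq_bigr => i _.
by rewrite !mxE; field; rewrite gt_eqF.
Qed.

(* Changing the mean from [a] to [z] multiplies the density by [e^L], [L] odd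
   about [a]; averaging with the reflection [y -> 2 a - y] makes [L] disappear. *)
Lemma expR_gaussian_shift_le (g : T -> R) (a z : T) (m : R) :
  measurable_fun setT g -> (forall y, 0 <= g y) ->
  (\int[gaussian_kernel eta a]_y (g y)%:E = m%:E)%E ->
  ((expR (m - (2 * eta)^-1 * sqnorm (z - a)))%:E <=
    \int[gaussian_kernel eta z]_y (expR (g y))%:E)%E.
Proof.
move=> mg g0 gm; pose L := tiltf a z; pose r y := a + a - y.
have mr : measurable_fun setT r by exact: measurable_reflect_rV.
have mL : measurable_fun setT L by exact: measurable_tiltf.
have mexp (f : T -> R) : measurable_fun setT f ->
    measurable_fun setT (fun y => (expR (f y))%:E).
  by move=> mf; apply/measurable_EFinP; exact: measurableT_comp.
have mgL : measurable_fun setT (fun y => (expR (g y + L y))%:E).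
  by apply: mexp; exact: measurable_funD.
have mgLr : measurable_fun setT (fun y => (expR (g (r y) - L y))%:E).
  by apply: mexp; apply: measurable_funB => //; exact: measurableT_comp.
set G := gaussian_kernel eta a.
have G1 : G setT = 1%E by exact: prob_kernel.
have shift : (\int[gaussian_kernel eta z]_y (expR (g y))%:E =
    (expR (- (2 * eta)^-1 * sqnorm (z - a)))%:E * \int[G]_y (expR (g y + L y))%:E)%E.
  rewrite !integral_gaussian_kernel//; last exact: mexp.
  rewrite -ge0_integralZl//.
  - apply: eq_integral => y _; rewrite (gaussian_pdf_shift a) -/(L y) expRD -!EFinM.
    by congr EFin; ring.
  - by apply: emeasurable_funM => //; apply/measurable_EFinP;
      exact: measurable_gaussian_pdfr.
  - by move=> y _; rewrite mule_ge0// lee_fin ?gaussian_pdf_ge0.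
have reflect : (\int[G]_y (expR (g (r y) - L y))%:E = \int[G]_y (expR (g y + L
  y))%:E)%E.
  rewrite -[RHS]integral_gaussian_reflect//; apply: eq_integral => y _.
  rewrite -/(r y); congr (expR (_ + _))%:E; rewrite /L /tiltf -mulrN -sumrN;
    congr (_ * _).
  by apply: eq_bigr => i _; rewrite !mxE -mulNr; congr (_ * _); ring.
rewrite shift expRD mulrC EFinM mulNr lee_wpmul2l ?lee_fin ?expR_ge0//.
(* [h] is the midpoint of the exponents [g + L] and [g \o r - L]. It is nonnegative, as
   [expR_integral_le] requires, which [g + L] need not be, and it has the same Gaussian mean [m] as
   [g]. *)
pose h y := (g y + g (r y)) / 2.
have mh : measurable_fun setT h.
  apply: measurable_funM; last exact: measurable_cst.
  by apply: measurable_funD => //; exact: measurableT_comp.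
have h0 y : 0 <= h y by rewrite divr_ge0// addr_ge0.
have hm : (\int[G]_y (h y)%:E = m%:E)%E.
  under eq_integral do rewrite EFinM muleC.
  rewrite ge0_integralZl//; last 2 first.
  - by apply/measurable_EFinP; apply: measurable_funD => //; exact: measurableT_comp.
  - by move=> y _; rewrite lee_fin addr_ge0.
  under eq_integral do rewrite EFinD.
  rewrite ge0_integralD//; last 4 first.
  - by move=> y _; rewrite lee_fin.
  - exact/measurable_EFinP.
  - by move=> y _; rewrite lee_fin.
  - by apply/measurable_EFinP; exact: measurableT_comp.
  rewrite (@integral_gaussian_reflect a (EFin \o g))//; last first.
    exact/measurable_EFinP.
  by rewrite gm -EFinD -EFinM; congr EFin; field.
apply: le_trans (expR_integral_le G1 mh h0 hm) _.
have two : (0 < 2%:E :> \bar R)%E by rewrite lte_fin.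
rewrite -(@lee_pmul2l _ 2%:E)//.
have -> : (2%:E * \int[G]_y (expR (g y + L y))%:E =
  \int[G]_y ((expR (g y + L y))%:E + (expR (g (r y) - L y))%:E))%E.
  rewrite ge0_integralD//.
  by rewrite reflect -[2]/(1 + 1) EFinD ge0_muleDl// mul1e.
rewrite -ge0_integralZl//; last exact: mexp.
apply: ge0_le_integral => //.
- by apply: measurable_funeM; exact: mexp.
- exact: emeasurable_funD.
move=> y _; rewrite -EFinM -EFinD lee_fin.
have l01 : 0 < (2^-1 : R) < 1 by lra.
have := expR_amgm l01 (g y + L y) (g (r y) - L y).
rewrite (_ : _ + _ = h y); last by rewrite /h; field.
by move=> H; lra.
Qed.

End gaussian_shift.

(** * The dual form of entropy contraction *)

Lemma ln_integral_expR_gaussian_le (R : realType) (n : nat) (mu eta : R)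
    (nu : probability 'rV[R]_n R) (g m : 'rV[R]_n -> R) (A J : R) :
  0 < mu -> 0 < eta -> strongly_log_concave mu nu ->
  measurable_fun setT g -> (forall y, 0 <= g y) ->
  measurable_fun setT m ->
  (forall x, \int[gaussian_kernel eta x]_y (g y)%:E = (m x)%:E)%E ->
  (\int[nu]_x (expR ((1 + mu * eta) * m x))%:E = A%:E)%E ->
  (\int[nu]_x \int[gaussian_kernel eta x]_y (expR (g y))%:E = J%:E)%E ->
  ln A <= (1 + mu * eta) * ln J.
Proof.
move=> mu0 eta0 [V [dV HV nuV]] mg g0 mm gm hA hJ.
set p := 1 + mu * eta in hA *; have p1 : 1 < p by rewrite ltrDl mulr_gt0.
have p0 : 0 < p by rewrite (lt_trans _ p1).
have m0 x : 0 <= m x.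
  by rewrite -lee_fin -gm; apply: integral_ge0 => y _; rewrite lee_fin.
have mV : measurable_fun setT V.
  apply: measurable_continuous_rV => x; apply: differentiable_continuous.
  exact: dV.1.
have meV : measurable_fun setT (fun x => expR (- V x)).
  by apply: measurableT_comp => //; exact: measurableT_comp.
have nuE (f : 'rV[R]_n -> \bar R) : measurable_fun setT f -> (forall x, 0 <= f x)%E ->
    (\int[nu]_x f x = \int[lebesgue_rV n]_x ((expR (- V x))%:E * f x))%E.
  by move=> mf f0; apply: integral_density => // x; exact: expR_ge0.
have mexp : measurable_fun setT (fun x => (expR (p * m x))%:E).
  apply/measurable_EFinP; apply: measurableT_comp => //.
  by apply: measurable_funM => //; exact: measurable_cst.
pose G z := (\int[gaussian_kernel eta z]_y (expR (g y))%:E)%E.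
have G0 z : (0 <= G z)%E by apply: integral_ge0 => y _; rewrite lee_fin expR_ge0.
have mG : measurable_fun setT G.
  apply: measurable_integral_gaussian; last by move=> y; rewrite lee_fin expR_ge0.
  by apply/measurable_EFinP; exact: measurableT_comp.
have ge1 (B : R) (f : 'rV[R]_n -> \bar R) : measurable_fun setT f ->
    (forall x, 1 <= f x)%E -> (\int[nu]_x f x = B%:E)%E -> 1 <= B.
  move=> mf f1 fB; rewrite -lee_fin -fB -(@probability_setT _ _ _ nu) -[leLHS]mul1e.
  rewrite -integral_cst//; apply: ge0_le_integral => // x _.
have A1 : 1 <= A.
  apply: ge1 mexp _ hA => x; rewrite lee_fin -expR0 ler_expR.
  by rewrite mulr_ge0// ltW.
have J1 : 1 <= J.
  apply: ge1 mG _ hJ => x;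
    rewrite -(@prob_kernel _ _ _ _ _ (gaussian_kernel eta) x) -[leLHS]mul1e.
  rewrite -integral_cst//; apply: ge0_le_integral => //.
    by apply/measurable_EFinP; exact: measurableT_comp.
  by move=> y _; rewrite lee_fin -expR0 ler_expR.
have A0 : 0 < A by exact: lt_le_trans A1.
have J0 : 0 < J by exact: lt_le_trans J1.
pose l := p^-1.
have l01 : 0 < l < 1 by rewrite invr_gt0 p0 invf_lt1.
have [l0 l1] := andP l01.
have key (x y : 'rV[R]_n) (s t : R) : ((expR s)%:E < (expR (- V x))%:E)%E ->
    ((expR t)%:E < (expR (- V y))%:E * (expR (p * m y))%:E)%E ->
    ((expR ((1 - l) * s + l * t))%:E <=
      (expR (- V ((1 - l) *: x + l *: y)))%:E * G ((1 - l) *: x + l *: y)%R)%E.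
  rewrite -EFinM -expRD !lte_fin !ltr_expR => sx ty; set z := (1 - l) *: x + l *: y.
  have l01' : 0 <= l <= 1 by rewrite !ltW.
  have Vz := strong_convexity dV HV x y l01'.
  rewrite -/z in Vz.
  have Gz := expR_gaussian_shift_le eta0 z mg g0 (gm y).
  have zE : sqnorm (z - y) = (1 - l) ^+ 2 * sqnorm (y - x).
    rewrite /sqnorm mulr_sumr; apply: eq_bigr => i _.
    by rewrite !mxE -exprMn -[RHS]sqrrN; congr (_ ^+ 2); ring.
  apply: (@le_trans _ _ ((expR (- V z))%:E *
      (expR (m y - (2 * eta)^-1 * sqnorm (z - y)))%:E)%E); last first.
    by rewrite lee_wpmul2l// lee_fin expR_ge0.
  rewrite -EFinM -expRD lee_fin ler_expR zE.
  set D := sqnorm (y - x) in Vz *.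
  (* This equality is what dictates [l = (1 + mu * eta)^-1]. *)
  have DE : (2 * eta)^-1 * ((1 - l) ^+ 2 * D) = mu / 2 * (l * (1 - l)) * D.
    rewrite /l /p; field; rewrite gt_eqF//= gt_eqF//.
  have lt : l * t <= m y - l * V y.
    have := ltW ty; rewrite -(ler_pM2l l0) mulrDr mulrA [l * p]mulVf ?gt_eqF// mul1r.
    by lra.
  have lsx : (1 - l) * s <= - ((1 - l) * V x).
    by rewrite -mulrN ler_wpM2l ?ltW// subr_gt0.
  by rewrite DE; lra.
have uE : (\int[lebesgue_rV n]_x (expR (- V x))%:E = 1)%E.
  by rewrite -(@probability_setT _ _ _ nu) nuV.
have PL (s t : R) : ((expR s)%:E < 1%:E)%E -> ((expR t)%:E < A%:E)%E ->
    ((expR ((1 - l) * s + l * t))%:E <= J%:E)%E.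
  rewrite -uE -hA -hJ nuE// ?nuE//.
  apply: (prekopa_leindler l01 _ _ _ _ _ _ key) => //.
  - exact/measurable_EFinP.
  - by apply: emeasurable_funM => //; exact/measurable_EFinP.
  - by apply: emeasurable_funM => //; exact/measurable_EFinP.
  - by move=> x; apply: mule_ge0; [rewrite lee_fin expR_ge0|exact: G0].
suff : l * ln A <= ln J.
  by rewrite -(ler_pM2l p0) mulrA mulfV ?gt_eqF// mul1r.
(* Prekopa-Leindler takes strict lower bounds, hence the margin [e] below [0] and [ln A]. The
   density [e^-V] has integral [1], so its term disappears as [e] tends to [0]. *)
apply/ler_addgt0Pr => e e0.
have h1 : expR (- e) < 1 by rewrite -expR0 ltr_expR oppr_lt0.
have h2 : expR (ln A - e) < A.
  by rewrite -[ltRHS]lnK ?posrE// ltr_expR ltrBlDr ltrDl.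
have := PL (- e) (ln A - e); rewrite !lte_fin lee_fin => /(_ h1 h2).
by rewrite -[leRHS]lnK ?posrE// ler_expR; lra.
Qed.

(** Fenchel-Young for the conjugate pair [x ln x - x] and [e^s]: the inequality [e^u >= 1 + u] at
    [u = s - ln x], multiplied by [x]. *)
Lemma young_entropy (R : realType) (x s : R) : 0 <= x ->
  x * s <= x * ln x - x + expR s.
Proof.
rewrite le_eqVlt => /predU1P[<-|x0].
  by rewrite !mul0r subr0 add0r expR_ge0.
have := expR_ge1Dx (s - ln x); rewrite expRD expRN lnK ?posrE//.
by rewrite ler_pdivlMr// mulrC; lra.
Qed.

Lemma integral_probability_cst d (T : measurableType d) (R : realType)
    (P : probability T R) (c : R) : (\int[P]__ c%:E = c%:E)%E.
Proof.
apply: etrans (integral_cst _ measurableT _) _.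
by rewrite [X in (_ * X)%E]probability_setT mule1.
Qed.

Lemma bounded_integral_fine d (T : measurableType d) (R : realType)
    (P : {measure set T -> \bar R}) (f : T -> R) (K : R) :
  P setT = 1%E -> measurable_fun setT f -> (forall x, 0 <= f x <= K) ->
  (\int[P]_x (f x)%:E = (fine (\int[P]_x (f x)%:E))%:E)%E /\
  0 <= fine (\int[P]_x (f x)%:E)%E <= K.
Proof.
move=> P1 mf f0K; set I := (\int[P]_x _)%E.
have I0 : (0 <= I)%E.
  by apply: integral_ge0 => x _; rewrite lee_fin; case/andP: (f0K x).
have IK : (I <= K%:E)%E.
  rewrite -[leRHS]mule1 -P1 -integral_cst//; apply: ge0_le_integral => //.
  - by move=> x _; rewrite lee_fin; case/andP: (f0K x).
  - exact/measurable_EFinP.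
  - by move=> x _; rewrite lee_fin; case/andP: (f0K x).
have If : I \is a fin_num by rewrite ge0_fin_numE// (le_lt_trans IK)// ltry.
by rewrite -!lee_fin fineK// I0.
Qed.

(** The contraction in dual form: for [t = ln (P f)] one would have [B = a], and this would be the
    entropy bound itself. Bounded [t] keeps [P t] and all the exponential integrals finite. *)
Lemma integral_rgd_test_le (R : realType) (n : nat) (mu eta : R)
    (nu : probability 'rV[R]_n R) (f t : 'rV[R]_n -> R) (a Phi K B : R) :
  0 < mu -> 0 < eta -> strongly_log_concave mu nu ->
  measurable_fun setT f -> (forall x, 0 <= f x) -> 0 < a ->
  (\int[nu]_x (f x)%:E = a%:E)%E ->
  nu.-integrable setT (fun x => (f x * ln (f x))%:E) ->
  (\int[nu]_x (f x * ln (f x))%:E = Phi%:E)%E ->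
  measurable_fun setT t -> (forall x, 0 <= t x <= K) ->
  (\int[nu]_x (expR (t x))%:E = B%:E)%E ->
  (\int[nu]_x ((\int[rgd eta nu x]_z (f z)%:E) * (t x)%:E)
    <= ((1 + mu * eta)^-1 * (Phi - a * ln a) + a * ln B)%:E)%E.
Proof.
move=> mu0 eta0 slc mf f0 a0 fa intPhi fPhi mt t0K tB.
set p := 1 + mu * eta; have p0 : 0 < p by rewrite ltr_wpDr// mulr_ge0 ?ltW.
have t0 x : 0 <= t x by case/andP: (t0K x).
have mtE : measurable_fun setT (EFin \o t) by exact/measurable_EFinP.
have met : measurable_fun setT (fun x => (expR (t x))%:E).
  by apply/measurable_EFinP; exact: measurableT_comp.
pose g y := fine (\int[tilt eta nu y]_x (t x)%:E)%E.
have mg : measurable_fun setT g.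
  apply: (measurableT_comp (fine_measurable measurableT)) => //.
  by apply: measurable_integral_tilt.
have gP y : (\int[tilt eta nu y]_x (t x)%:E = (g y)%:E)%E /\ 0 <= g y <= K.
  by apply: bounded_integral_fine => //; exact: prob_kernel.
have g0 y : 0 <= g y by case: (gP y) => _ /andP[].
have meg : measurable_fun setT (fun x => (expR (g x))%:E).
  by apply/measurable_EFinP; exact: measurableT_comp.
pose m x := fine (\int[gaussian_kernel eta x]_y (g y)%:E)%E.
have mm : measurable_fun setT m.
  apply: (measurableT_comp (fine_measurable measurableT)) => //.
  by apply: measurable_integral_gaussian => //; exact/measurable_EFinP.
have mP x : (\int[gaussian_kernel eta x]_y (g y)%:E = (m x)%:E)%E /\ 0 <= m x <= K.
  apply: bounded_integral_fine => //; first exact: prob_kernel.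
  by move=> y; case: (gP y).
have m0 x : 0 <= m x by case: (mP x) => _ /andP[].
have mK x : m x <= K by case: (mP x) => _ /andP[].
have mpm : measurable_fun setT (fun x => p * m x).
  by apply: measurable_funM => //; exact: measurable_cst.
have mepm : measurable_fun setT (fun x => expR (p * m x)) by exact: measurableT_comp.
have nuT : nu setT = 1%E by exact: probability_setT.
have [x|hA _] := @bounded_integral_fine _ _ _ nu (fun x => expR (p * m x)) (expR (p *
  K)) nuT mepm.
  by rewrite expR_ge0 ler_expR ler_wpM2l// ltW.
set A := fine _ in hA *.
have PtE x : (\int[rgd eta nu x]_z (t z)%:E = (m x)%:E)%E.
  rewrite integral_rgd// -(mP x).1; apply: eq_integral => y _; exact: (gP y).1.
(* Jensen for the tilt gives [G (e^(S t)) <= G (S (e^t)) = P (e^t)], whose [nu]-integral is that of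
   [e^t] by stationarity. *)
have JB : (\int[nu]_x \int[gaussian_kernel eta x]_y (expR (g y))%:E <= B%:E)%E.
  rewrite -tB -(integral_rgd_stationary nu eta0 met) => [|x]; last exact: expR_ge0.
  apply: ge0_le_integral => //.
  - by move=> x _; apply: integral_ge0 => y _; rewrite lee_fin expR_ge0.
  - by apply: measurable_integral_gaussian => // y; rewrite lee_fin expR_ge0.
  - by apply: measurable_integral_rgd => // y; rewrite lee_fin expR_ge0.
  - move=> x _; rewrite integral_rgd//.
    apply: ge0_le_integral => //.
    + by apply: measurable_integral_tilt => // y; rewrite lee_fin expR_ge0.
    + move=> y _; apply: expR_integral_le => //; last exact: (gP y).1.
      exact: prob_kernel.
have JB1 : (1 <= \int[nu]_x \int[gaussian_kernel eta x]_y (expR (g y))%:E)%E.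
  rewrite -nuT -[leLHS]mul1e -integral_cst//; apply: ge0_le_integral => //.
  - by apply: measurable_integral_gaussian => // y; rewrite lee_fin expR_ge0.
  - move=> x _; rewrite -(@prob_kernel _ _ _ _ _ (gaussian_kernel eta) x) -[leLHS]mul1e.
    rewrite -integral_cst//; apply: ge0_le_integral => //.
    by move=> y _; rewrite lee_fin -expR0 ler_expR.
set J := fine (\int[nu]_x \int[gaussian_kernel eta x]_y (expR (g y))%:E)%E.
have hJ : (\int[nu]_x \int[gaussian_kernel eta x]_y (expR (g y))%:E = J%:E)%E.
  rewrite fineK// ge0_fin_numE; first by rewrite (le_lt_trans JB)// ltry.
  exact: le_trans JB1.
rewrite hJ !lee_fin in JB JB1.
have J0 : 0 < J by exact: lt_le_trans JB1.
have lnAJ : ln A <= p * ln J.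
  exact: (ln_integral_expR_gaussian_le mu0 eta0 slc mg g0 mm (fun x => (mP x).1) hA hJ).
have lnJB : ln J <= ln B by rewrite ler_ln// posrE// (lt_le_trans J0).
have A0 : 0 < A.
  apply: (@lt_le_trans _ _ 1) => //; rewrite -lee_fin -hA -nuT -[leLHS]mul1e.
  rewrite -integral_cst//; apply: ge0_le_integral => //.
  - exact/measurable_EFinP.
  - by move=> x _; rewrite lee_fin -expR0 ler_expR mulr_ge0// ltW.
rewrite rgd_reversible//; last exact/measurable_EFinP.
under eq_integral do rewrite PtE -EFinM.
have intf : nu.-integrable setT (EFin \o f).
  apply/integrableP; split; first exact/measurable_EFinP.
  under eq_integral do rewrite /= ger0_norm//.
  by rewrite fa ltry.
have inte : nu.-integrable setT (fun x => (expR (p * m x))%:E).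
  apply/integrableP; split; first exact/measurable_EFinP.
  under eq_integral do rewrite /= ger0_norm ?expR_ge0//.
  by rewrite hA ltry.
have intfm : nu.-integrable setT (fun x => (f x * m x)%:E).
  apply: (le_integrable _ _ _ (integrableZl _ K intf)) => //.
  - by apply/measurable_EFinP; exact: measurable_funM.
  - move=> x _; rewrite lee_fin /= !ger0_norm ?mulr_ge0//; last first.
      exact: le_trans (mK x).
    by rewrite mulrC ler_wpM2r.
(* The optimal shift in Young's inequality: it makes both sides tight when [f] is
   proportional to [expR (p * m)]. *)
pose L := ln A - ln a.
have eL : expR (- L) = a / A.
  by rewrite /L opprB expRD expRN !lnK.
have ub : (\int[nu]_x (p%:E * (f x * m x)%:E) <=
    \int[nu]_x ((f x * ln (f x))%:E + ((L - 1)%:E * (f x)%:E +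
      (expR (- L))%:E * (expR (p * m x))%:E)))%E.
  apply: le_integral => //.
  - exact: integrableZl.
  - by apply: integrableD => //; apply: integrableD => //; exact: integrableZl.
  - move=> x _; rewrite -!EFinM -!EFinD lee_fin.
    have := young_entropy (p * m x - L) (f0 x).
    by rewrite expRD mulrBr [f x * (p * _)]mulrCA; lra.
have intr : nu.-integrable setT (fun x => (L - 1)%:E * (f x)%:E +
      (expR (- L))%:E * (expR (p * m x))%:E)%E.
  by apply: integrableD => //; exact: integrableZl.
rewrite integralZl// integralD// integralD// ?integralZl// in ub; last 2 first.
- exact: integrableZl.
- exact: integrableZl.
rewrite fPhi fa hA eL -!EFinM -!EFinD divfK ?gt_eqF// in ub.
rewrite -(@lee_pmul2l _ p%:E)//.
apply: (le_trans ub); rewrite -EFinM lee_fin mulrDr mulrA mulfV ?gt_eqF// mul1r.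
have : a * ln A <= a * (p * ln B).
  by rewrite ler_pM2l// (le_trans lnAJ)// ler_pM2l.
by rewrite /L; lra.
Qed.

(** * Truncation and passage to the limit *)

(** Fatou's lemma; the error [1 / (k + 1)] leaves room for the bias that truncation introduces in
    the constants. *)
Lemma integral_le_of_eventually_eq d (T : measurableType d) (R : realType)
    (mu : {measure set T -> \bar R}) (F : nat -> T -> R) (G : T -> R) (C : R) :
  (forall k, measurable_fun setT (F k)) -> (forall k x, 0 <= F k x) ->
  (forall x, \forall k \near \oo, F k x = G x) ->
  (forall k, \int[mu]_x (F k x)%:E <= (C + k.+1%:R^-1)%:E)%E ->
  (\int[mu]_x (G x)%:E <= C%:E)%E.
Proof.
move=> mF F0 FG FC.
rewrite (eq_integral (fun x => limn_einf (fun k => (F k x)%:E))); last first.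
  move=> x _; have FGx : (F k x)%:E @[k --> \oo] --> (G x)%:E.
    by apply: cvg_near_cst; apply: filterS (FG x) => k ->.
  by rewrite (cvg_limn_einf_sup FGx).1.
apply: (@le_trans _ _ (limn_einf (fun k => \int[mu]_x (F k x)%:E))%E).
  apply: fatou => //; first by move=> k; exact/measurable_EFinP.
  by move=> k x _; rewrite lee_fin.
apply/lee_addgt0Pr => e e0; rewrite limn_einf_lim.
apply: lime_le; first exact: is_cvg_einfs.
near=> k; apply: (@le_trans _ _ (\int[mu]_x (F k x)%:E)%E).
  by apply: ereal_inf_lbound; exists k => //=.
apply: (le_trans (FC k)); rewrite -EFinD lee_fin lerD2l; apply: ltW.
by near: k; exact: near_infty_natSinv_lt (PosNum e0).
Unshelve. all: by end_near. Qed.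

Lemma measurable_lne (R : realType) : measurable_fun [set: \bar R] (@lne R).
Proof.
rewrite (_ : @lne R = fun x => if (+oo <= x)%E then +oo%E else
    if fine x <= 0 then -oo%E else (ln (fine x))%:E); last first.
  by apply/funext => -[r||] /=; rewrite ?lexx// leye_eq.
apply: measurable_fun_ifT => //.
  by apply: measurable_fun_lee => //; exact: measurable_cst.
apply: measurable_fun_ifT => //.
- by apply: measurable_fun_ler => //; exact: measurable_cst.
- by apply/measurable_EFinP; exact: measurableT_comp.
Qed.

(** At [s = 0] the two logarithms take different values, but the factor [0] annihilates both. *)
Lemma xlnxE (R : realType) (s : R) : 0 <= s -> (s%:E * lne s%:E = (s * ln s)%:E)%E.
Proof.
rewrite le_eqVlt => /predU1P[<-|s0]; first by rewrite mul0e mul0r.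
by rewrite lne_EFin.
Qed.

Section truncated_log.
Context {R : realType}.

Lemma xlnx_ge (r : R) : 0 <= r -> -1 <= r * ln r.
Proof. by move=> r0; have := young_entropy 0 r0; rewrite mulr0 expR0; lra. Qed.

(** Truncation on both sides, at reciprocal levels, so that [ln (clamp k r)] stays within
    [ln (k + 1)] of [0]. *)
Definition clamp (k : nat) (r : R) : R := Num.max k.+1%:R^-1 (Num.min r k.+1%:R).

Lemma clamp_itv k r : k.+1%:R^-1 <= clamp k r <= k.+1%:R.
Proof.
rewrite /clamp le_max lexx/= ge_max ge_min lexx orbT andbT.
rewrite (@le_trans _ _ 1)//; last by rewrite ler1n.
by rewrite invf_le1// ler1n.
Qed.

Lemma clamp_gt0 k r : 0 < clamp k r.
Proof. by have /andP[+ _] := clamp_itv k r; apply: lt_le_trans; rewrite invr_gt0. Qed.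

Lemma clamp_le k r : 0 <= r -> clamp k r <= r + k.+1%:R^-1.
Proof.
move=> r0; rewrite /clamp ge_max lerDr r0/=.
by rewrite ge_min lerDl invr_ge0 ler0n.
Qed.

Lemma measurable_clamp k : measurable_fun [set: R] (clamp k).
Proof.
apply: measurable_maxr; first exact: measurable_cst.
by apply: measurable_minr => //; exact: measurable_cst.
Qed.

(** Clamping does not decrease a value below [1] and leaves any other at least [1], so the lower
    bound of [r ln r] survives, uniformly in [k]. *)
Lemma xln_clamp_ge k r : 0 <= r -> -1 <= r * ln (clamp k r).
Proof.
move=> r0; have [r1|r1] := leP 1 r.
  have c1 : 1 <= clamp k r by rewrite /clamp le_max le_min r1 ler1n orbT.
  by rewrite (@le_trans _ _ 0)// mulr_ge0// ln_ge0.
apply: le_trans (xlnx_ge r0) _; have [->|rn0] := eqVneq r 0; first by rewrite !mul0r.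
have r0' : 0 < r by rewrite lt_neqAle eq_sym rn0.
rewrite ler_wpM2l// ler_ln// ?posrE ?clamp_gt0// /clamp le_max le_min lexx/=.
by rewrite (_ : r <= k.+1%:R) ?orbT// (le_trans (ltW r1))// ler1n.
Qed.

Lemma xln_clamp_eventually (r : R) : 0 <= r ->
  \forall k \near \oo, r * ln (clamp k r) = r * ln r.
Proof.
rewrite le_eqVlt => /predU1P[<-|r0]; first by apply: nearW => k; rewrite !mul0r.
near=> k; congr (_ * ln _); rewrite /clamp min_l.
  by rewrite max_r//; apply: ltW; near: k; exact: near_infty_natSinv_lt (PosNum r0).
apply: (@le_trans _ _ k%:R); last by rewrite ler_nat.
by near: k; exact: nbhs_infty_ger.
Unshelve. all: by end_near. Qed.

End truncated_log.

Lemma integral_rgd_xlnx_le (R : realType) (n : nat) (mu eta : R)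
    (nu : probability 'rV[R]_n R) (f : 'rV[R]_n -> R) (a Phi : R) :
  0 < mu -> 0 < eta -> strongly_log_concave mu nu ->
  measurable_fun setT f -> (forall x, 0 <= f x) -> 0 < a ->
  (\int[nu]_x (f x)%:E = a%:E)%E ->
  nu.-integrable setT (fun x => (f x * ln (f x))%:E) ->
  (\int[nu]_x (f x * ln (f x))%:E = Phi%:E)%E ->
  (\int[nu]_x ((\int[rgd eta nu x]_z (f z)%:E) *
                lne (\int[rgd eta nu x]_z (f z)%:E)) <=
    ((1 + mu * eta)^-1 * (Phi - a * ln a) + a * ln a)%:E)%E.
Proof.
move=> mu0 eta0 slc mf f0 a0 fa intPhi fPhi.
pose h x := (\int[rgd eta nu x]_z (f z)%:E)%E.
rewrite -[leLHS]/(\int[nu]_x (h x * lne (h x)))%E.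
set D := _ * (Phi - _).
have mfE : measurable_fun setT (EFin \o f) by exact/measurable_EFinP.
have f0E x : (0 <= (EFin \o f) x)%E by rewrite lee_fin.
have mh : measurable_fun setT h by exact: measurable_integral_rgd.
have h0 x : (0 <= h x)%E by apply: integral_ge0 => z _; exact: f0E.
have ha : (\int[nu]_x h x = a%:E)%E by rewrite -fa; exact: integral_rgd_stationary.
have inth : nu.-integrable setT h.
  apply/integrableP; split => //.
  by under eq_integral do rewrite gee0_abs//; rewrite ha ltry.
(* [P f] has the finite integral [a], hence is infinite only on a [nu]-null set, and the real-valued
   [r] can replace it. *)
pose r x := fine (h x).
have mr : measurable_fun setT r.
  exact: (measurableT_comp (fine_measurable measurableT)).
have mrE : measurable_fun setT (EFin \o r) by exact/measurable_EFinP.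
have r0 x : 0 <= r x by exact: fine_ge0.
have hr : ae_eq nu setT h (EFin \o r).
  have := integrable_ae measurableT inth.
  by apply: filterS => x hx _; rewrite /= fineK//; exact: hx.
have ra : (\int[nu]_x (r x)%:E = a%:E)%E.
  by rewrite -ha; apply/esym; apply: ae_eq_integral.
have mln : measurable_fun setT (fun x => r x * ln (r x)).
  by apply: measurable_funM => //; exact: measurableT_comp.
have mlne : measurable_fun setT (fun x => h x * lne (h x))%E.
  by apply: emeasurable_funM => //; exact: (measurableT_comp (@measurable_lne R)).
rewrite (@ae_eq_integral _ _ _ nu setT (fun x => (r x * ln (r x))%:E))//; last 2 first.
- exact/measurable_EFinP.
- by apply: filterS hr => x /[apply] -> /=; rewrite xlnxE.
(* Adding [1] makes the integrands nonnegative, as Fatou's lemma requires. *)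
pose F k x := r x * ln (clamp k (r x)) + 1.
have mlc k : measurable_fun setT (fun x => ln (clamp k (r x))).
  apply: measurableT_comp => //.
  by apply: (measurableT_comp (measurable_clamp k)).
have mF k : measurable_fun setT (F k).
  by apply: measurable_funD => //; apply: measurable_funM.
have F0 k x : 0 <= F k x by rewrite /F; have := xln_clamp_ge k (r0 x); lra.
have FC k : (\int[nu]_x (F k x)%:E <= (D + a * ln a + 1 + k.+1%:R^-1)%:E)%E.
  pose N : R := k.+1%:R; have N1 : 1 <= N by rewrite ler1n.
  have N0 : 0 < N by exact: lt_le_trans N1.
  have NV0 : 0 < N^-1 by rewrite invr_gt0.
  (* The constant [ln N] only serves to make the test function nonnegative. *)
  pose t x := ln (clamp k (r x)) + ln N.
  have mt : measurable_fun setT t by exact: measurable_funD.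
  have tK x : 0 <= t x <= ln N + ln N.
    have /andP[c1 c2] := clamp_itv k (r x).
    rewrite /t lerD2r ler_ln ?posrE ?clamp_gt0// c2 andbT -lerBlDr sub0r -lnV ?posrE//.
    by rewrite ler_ln// posrE clamp_gt0.
  have etE x : expR (t x) = N * clamp k (r x).
    by rewrite /t expRD !lnK ?posrE ?clamp_gt0// mulrC.
  have nuT : nu setT = 1%E by exact: probability_setT.
  have met : measurable_fun setT (fun x => expR (t x)) by exact: measurableT_comp.
  have etK x : 0 <= expR (t x) <= expR (ln N + ln N).
    by rewrite expR_ge0 ler_expR; case/andP: (tK x).
  have [hB _] := bounded_integral_fine nuT met etK.
  set B := fine _ in hB.
  have BN : B <= N * (a + N^-1).
    rewrite -lee_fin -hB; apply: (@le_trans _ _ (\int[nu]_x (N%:E * ((r x)%:E +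
      N^-1%:E)))%E).
      apply: ge0_le_integral => //.
      - exact/measurable_EFinP.
      - by apply: measurable_funeM; apply: emeasurable_funD.
      - move=> x _; rewrite etE -EFinD -EFinM lee_fin ler_pM2l//.
        exact: clamp_le.
    rewrite ge0_integralZl//; last 3 first.
    - by apply: emeasurable_funD.
    - by move=> x _; rewrite -EFinD lee_fin addr_ge0// ltW.
    - by rewrite lee_fin ltW.
    rewrite ge0_integralD//; last by move=> x _; rewrite lee_fin ltW.
    - by rewrite ra integral_probability_cst.
    - by move=> x _; rewrite lee_fin.
  have B1 : 1 <= B.
    rewrite -lee_fin -hB -nuT -[leLHS]mul1e -integral_cst//;
      apply: ge0_le_integral => //.
    - exact/measurable_EFinP.
    - by move=> x _; rewrite lee_fin -expR0 ler_expR; case/andP: (tK x).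
  have B0 : 0 < B by exact: lt_le_trans B1.
  (* From [B <= N a (1 + 1 / (N a))] and [ln (1 + u) <= u]; multiplied by [a], the error [1 / (N a)]
     becomes exactly [1 / N]. *)
  have lnB : a * ln B <= a * ln N + a * ln a + N^-1.
    have : ln B <= ln (N * (a * (1 + N^-1 / a))).
      rewrite ler_ln ?posrE//; first by apply: (le_trans BN);
        rewrite ler_pM2l// mulrDr mulr1 mulrCA mulfV ?gt_eqF// mulr1.
      by rewrite !mulr_gt0// addr_gt0// divr_gt0.
    have u0 : 0 < 1 + N^-1 / a by rewrite addr_gt0// divr_gt0.
    rewrite !lnM ?posrE ?mulr_gt0// => lnB.
    have lnu : ln (1 + N^-1 / a) <= N^-1 / a.
      by rewrite -ler_expR lnK ?posrE// expR_ge1Dx.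
    rewrite (_ : N^-1 = a * (N^-1 / a)); last by rewrite mulrCA mulfV ?mulr1// gt_eqF.
    by rewrite -!mulrDr ler_pM2l// (le_trans lnB)// -addrA !lerD2l.
  have main := integral_rgd_test_le mu0 eta0 slc mf f0 a0 fa intPhi fPhi mt tK hB.
  rewrite -/D in main.
  have rt : (\int[nu]_x (h x * (t x)%:E) = \int[nu]_x (r x * t x)%:E)%E.
    apply: ae_eq_integral => //.
    - by apply: emeasurable_funM => //; exact/measurable_EFinP.
    - by apply/measurable_EFinP; exact: measurable_funM.
    - by apply: filterS hr => x /[apply] -> /=.
  have t0 x : 0 <= t x by case/andP: (tK x).
  (* As [r] has integral [a], the shift of [t] by [ln N] adds exactly [a ln N], which cancels the
     same term in [lnB]. It is kept on the left so that every integrand is nonnegative. *)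
  have split : (\int[nu]_x (F k x)%:E + (a * ln N)%:E = \int[nu]_x (r x * t x)%:E +
    1)%E.
    rewrite mulrC EFinM -ra -ge0_integralZl ?lee_fin ?ln_ge0//; last first.
      by move=> x _; rewrite lee_fin.
    rewrite -ge0_integralD//; last 4 first.
    - by move=> x _; rewrite lee_fin.
    - exact/measurable_EFinP.
    - by move=> x _; rewrite lee_fin mulr_ge0// ln_ge0.
    - exact: measurable_funeM.
    rewrite -[X in (_ + X)%E]nuT -[X in (_ + X)%E]mul1e -integral_cst//.
    rewrite -ge0_integralD//; last 2 first.
    - by move=> x _; rewrite lee_fin mulr_ge0.
    - by apply/measurable_EFinP; exact: measurable_funM.
    by apply: eq_integral => x _; rewrite -EFinM -!EFinD /F /t; congr EFin; ring.
  rewrite -(@leeD2rE _ (a * ln N)%:E)// split -rt.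
  apply: (le_trans (leeD main (lexx _))).
  rewrite -!EFinD lee_fin -/N.
  rewrite [leRHS](_ : _ = D + (a * ln N + a * ln a + N^-1) + 1); last by ring.
  by rewrite lerD2r lerD2l.
have le1 : (\int[nu]_x (r x * ln (r x) + 1)%:E <= (D + a * ln a + 1)%:E)%E.
  apply: (integral_le_of_eventually_eq mF F0 _ FC) => x.
  by apply: filterS (xln_clamp_eventually (r0 x)) => k; rewrite /F => ->.
have intq : nu.-integrable setT (fun x => (r x * ln (r x) + 1)%:E).
  apply/integrableP; split; first by apply/measurable_EFinP; exact: measurable_funD.
  apply: le_lt_trans (ltry (D + a * ln a + 1)); apply: le_trans le1.
  rewrite le_eqVlt; apply/orP; left; apply/eqP; apply: eq_integral => x _.
  by rewrite gee0_abs// lee_fin; have := xlnx_ge (r0 x); lra.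
rewrite (eq_integral (fun x => (r x * ln (r x) + 1)%:E - 1%:E)%E); last first.
  by move=> x _; rewrite -EFinB addrK.
rewrite integralB//; last exact: finite_measure_integrable_cst.
by rewrite integral_probability_cst leeBlDr.
Qed.

(** Positivity of the entropy excludes [\int f = +oo], where it would be [-oo], and [\int f = 0],
    where [f] vanishes almost everywhere and it would be [0]. Since [r ln r >= -1], the negative
    part of [f ln f] is integrable, and finiteness of the entropy then bounds the positive part. *)
Lemma entropy_fin (R : realType) d (T : measurableType d) (nu : probability T R)
    (f : T -> R) :
  measurable_fun setT f -> (forall x, 0 <= f x) ->
  (0 < entropy nu (EFin \o f) < +oo)%E ->
  exists a Phi : R, [/\ 0 < a, (\int[nu]_x (f x)%:E = a%:E)%E,
    nu.-integrable setT (fun x => (f x * ln (f x))%:E),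
    (\int[nu]_x (f x * ln (f x))%:E = Phi%:E)%E &
    entropy nu (EFin \o f) = (Phi - a * ln a)%:E].
Proof.
move=> mf f0 /andP[]; rewrite /entropy /=.
under eq_integral do rewrite xlnxE//.
set q := fun x => (f x * ln (f x))%:E : \bar R.
have mfln : measurable_fun setT (fun x => f x * ln (f x)).
  by apply: measurable_funM => //; exact: measurableT_comp.
have mq : measurable_fun setT q by exact/measurable_EFinP.
have mfE : measurable_fun setT (EFin \o f) by exact/measurable_EFinP.
set I := (\int[nu]_x (f x)%:E)%E; rewrite -[X in (0 < X - _)%E]/(\int[nu]_x q x)%E.
have I0 : (0 <= I)%E by apply: integral_ge0 => x _; rewrite lee_fin.
case IE : I I0 => [a||]//=; last by rewrite addeNy.
rewrite lee_fin le_eqVlt => /predU1P[a0|a0].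
  have fae : ae_eq nu setT (EFin \o f) (cst 0%E).
    apply/ae_eq_integral_abs => //; transitivity I; last by rewrite IE -a0.
    by apply: eq_integral => x _; rewrite gee0_abs// lee_fin.
  rewrite (@ae_eq_integral _ _ _ nu setT (cst 0%E) q)//; last first.
    by apply: filterS fae => x /[apply] [] [fx0]; rewrite /q fx0 mul0r.
  by rewrite integral0 -a0 mul0e sube0 ltxx.
rewrite leNgt a0 /= => _ Ioo.
have qneg x : (q^\- x <= 1)%E.
  by rewrite funenegE ge_max lee_fin/= lee_fin ler01 andbT; have := xlnx_ge (f0 x); lra.
have negfin : (\int[nu]_x q^\- x <= 1)%E.
  apply: (@le_trans _ _ (\int[nu]_x 1)%E).
    by apply: ge0_le_integral => //; exact: measurable_funeneg.
  by rewrite integral_probability_cst.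
have neg0 : (0 <= \int[nu]_x q^\- x)%E by exact: integral_ge0.
have negf : (\int[nu]_x q^\- x)%E \is a fin_num.
  by rewrite ge0_fin_numE// (le_lt_trans negfin)// ltry.
have posoo : (\int[nu]_x q^\+ x < +oo)%E.
  rewrite ltey; apply/eqP => qoo; move: Ioo.
  by rewrite integralE qoo -(fineK negf) /= ltxx.
have intq : nu.-integrable setT q.
  apply/integrableP; split => //; rewrite -[fun x => _]/(abse \o q) fune_abse.
  rewrite ge0_integralD//; last 2 first.
  - exact: measurable_funepos.
  - exact: measurable_funeneg.
  by rewrite lte_add_pinfty// (le_lt_trans negfin)// ltry.
have qf : (\int[nu]_x q x)%E \is a fin_num by exact: integrable_fin_num.
exists a, (fine (\int[nu]_x q x)); split => //; first by rewrite fineK.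
by rewrite EFinB fineK.
Qed.

Theorem theorem58 (R : realType) (n : nat) (mu : R) (mu_gt0 : 0 < mu)
    (nu : probability 'rV[R]_n R) (nu_slc : strongly_log_concave mu nu)
    (eta : R) (eta_gt0 : 0 < eta) :
  ((mu / (mu + 1 / eta))%:E <= rho_LS (rgd eta nu) nu)%E.
Proof.
set c := (1 + mu * eta)^-1.
have p0 : 0 < 1 + mu * eta by rewrite addr_gt0// mulr_gt0.
have -> : mu / (mu + 1 / eta) = 1 - c.
  by rewrite /c; field; rewrite !gt_eqF.
rewrite /rho_LS EFinB leeB//.
apply: ge_ereal_sup => _ [f [mf f0 fE] <-].
have [a [Phi [a0 fa intPhi fPhi entf]]] := entropy_fin mf f0 fE.
move: fE; rewrite entf lte_fin => /andP[E0 _].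
have mfE : measurable_fun setT (EFin \o f) by exact/measurable_EFinP.
have f0E x : (0 <= (EFin \o f) x)%E by rewrite lee_fin.
rewrite inver gt_eqF// lee_pdivrMr// -EFinM /entropy /kernel_apply.
(* By stationarity [P f] has the same mean [a] as [f], so both entropies subtract the same
   [a ln a]. *)
rewrite integral_rgd_stationary// fa lne_EFin//.
rewrite leeBlDr// -EFinM -EFinD.
exact: (integral_rgd_xlnx_le mu_gt0 eta_gt0 nu_slc mf f0 a0 fa intPhi fPhi).
Qed.
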